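(* Let $d\geq 1$, let $A$ be a finite-dimensional algebra over a field and let $\mathcal{M}\subseteq \operatorname{mod}A$ be a $d$-cluster tilting subcategory. Then $$\mathcal{P}_d(\mathcal{M})=\{P_\bullet\in C^{[-d,0]}(\operatorname{proj}A)\mid H_0(P_\bullet)\in\mathcal{M}\text{ and }H_{-i}(P_\bullet)=0\text{ for }i=1,\dots,d-1\}$$ is a $d$-cluster tilting subcategory of the exact category $C^{[-d,0]}(\operatorname{proj}A)$.
   Context: $\operatorname{mod}A$ is the category of finitely generated right $A$-modules. All subcategories are full and closed under isomorphisms, finite direct sums and direct summands. A functorially finite subcategory $\mathcal{M}\subseteq\operatorname{mod}A$ is $d$-cluster tilting if $\mathcal{M}=\{X\mid \operatorname{Ext}^i_A(X,M)=0\ \forall M\in\mathcal{M},\,1\le i\le d-1\}=\{Y\mid \operatorname{Ext}^i_A(M,Y)=0\ \forall M\in\mathcal{M},\,1\le i\le d-1\}$. $C^{[-d,0]}(\operatorname{proj}A)$ is the category of complexes $P_{-d}\to\cdots\to P_{-1}\to P_0$ of finitely generated projective $A$-modules concentrated in degrees $-d,\dots,0$ (differentials raise degree by one), with usual chain maps. It is an exact category (in the sense of Quillen) whose conflations are the degree-wise split short exact sequences. A subcategory $\mathcal{N}$ of an exact category $\mathcal{E}$ is $d$-cluster tilting if it is generating (every $X\in\mathcal{E}$ admits a deflation $N\twoheadrightarrow X$ with $N\in\mathcal{N}$), cogenerating (every $X\in\mathcal{E}$ admits an inflation $X\rightarrowtail N$ with $N\in\mathcal{N}$), functorially finite, and satisfies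 $\mathcal{N}=\{X\in\mathcal{E}\mid \operatorname{Ext}^i_{\mathcal{E}}(X,N)=0\ \forall N\in\mathcal{N},\,1\le i\le d-1\}=\{Y\in\mathcal{E}\mid \operatorname{Ext}^i_{\mathcal{E}}(N,Y)=0\ \forall N\in\mathcal{N},\,1\le i\le d-1\}$, where $\operatorname{Ext}^i_{\mathcal{E}}$ denotes Yoneda extensions in $\mathcal{E}$. *)

(* Defs.v *)
From HB Require Import structures.
From mathcomp Require Import all_boot all_order all_algebra all_field.
From mathcomp Require Import boolp.
From Stdlib Require Import Relation_Operators.

Set Implicit Arguments.
Unset Strict Implicit.
Unset Printing Implicit Defensive.

Import GRing.Theory.
Local Open Scope ring_scope.
Local Open Scope quotient_scope.

Declare Scope precat_scope.
Delimit Scope precat_scope with precat.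
Local Open Scope precat_scope.

Record precat := Precat {
  obj :> Type;
  hom : obj -> obj -> zmodType;
  idm : forall X, hom X X;
  comp : forall X Y Z, hom Y Z -> hom X Y -> hom X Z;
  compA : forall W X Y Z (h : hom Y Z) (g : hom X Y) (f : hom W X),
    comp h (comp g f) = comp (comp h g) f;
  comp1m : forall X Y (f : hom X Y), comp (idm Y) f = f;
  compm1 : forall X Y (f : hom X Y), comp f (idm X) = f;
  compDl : forall X Y Z (g g' : hom Y Z) (f : hom X Y),
    comp (g + g') f = comp g f + comp g' f;
  compDr : forall X Y Z (g : hom Y Z) (f f' : hom X Y),
    comp g (f + f') = comp g f + comp g f' }.

Arguments hom {p} X Y.
Arguments idm {p} X.
Arguments comp {p X Y Z} g f.
Notation "g \c f" := (comp g f)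
  (at level 40, left associativity) : precat_scope.

(* The data of an exact category: a preadditive category with a class of
   conflations.  Quillen's axioms are not recorded, since none of the notions
   below refers to them. *)
Record exactData := ExactData {
  exact_precat :> precat;
  conflation : forall X Y Z : exact_precat, hom X Y -> hom Y Z -> Prop }.

Arguments conflation {e X Y Z} f g.

Section Subcategories.
Variable C : precat.

Definition isomorphic (X Y : C) : Prop :=
  exists (f : hom X Y) (g : hom Y X), g \c f = idm X /\ f \c g = idm Y.

Definition zero_object (Z : C) : Prop :=
  (forall X (f : hom X Z), f = 0) /\ (forall X (f : hom Z X), f = 0).

Definition direct_sum (X Y S : C) : Prop :=
  exists (i1 : hom X S) (i2 : hom Y S) (p1 : hom S X) (p2 : hom S Y),
    [/\ p1 \c i1 = idm X, p2 \c i2 = idm Y, p1 \c i2 = 0, p2 \c i1 = 0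
      & i1 \c p1 + i2 \c p2 = idm S].

(* Full subcategories closed under isomorphisms, finite (including empty)
   direct sums and direct summands, given by their class of objects. *)
Definition additive_subcat (N : C -> Prop) : Prop :=
  [/\ forall X Y, isomorphic X Y -> N X -> N Y,
      forall Z, zero_object Z -> N Z,
      forall X Y S, direct_sum X Y S -> N X -> N Y -> N S
    & forall X Y S, direct_sum X Y S -> N S -> N X].

Definition contravariantly_finite (N : C -> Prop) : Prop :=
  forall X, exists (M : C) (f : hom M X), N M /\
    forall M' (g : hom M' X), N M' -> exists h : hom M' M, f \c h = g.

Definition covariantly_finite (N : C -> Prop) : Prop :=
  forall X, exists (M : C) (f : hom X M), N M /\
    forall M' (g : hom X M'), N M' -> exists h : hom M M', h \c f = g.

Definition functorially_finite (N : C -> Prop) : Prop :=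
  contravariantly_finite N /\ covariantly_finite N.

End Subcategories.

Section YonedaExt.
Variable E : exactData.

Record ses (Y X : E) := Ses {
  mid : E;
  infl : hom Y mid;
  defl : hom mid X;
  sesP : conflation infl defl }.

(* [yext n Y X] consists of the (n+1)-fold extensions
     0 -> Y -> E_n -> ... -> E_0 -> X -> 0,
   presented as a splice of n+1 conflations: the last one is K >-> E_0 ->> X,
   and the previous ones form an n-fold extension of K by Y. *)
Fixpoint yext (n : nat) (Y X : E) : Type :=
  if n is m.+1 then {K : E & (yext m Y K * ses K X)%type} else ses Y X.

Definition ses_mor (Y Y' X X' : E) (y : hom Y Y') (x : hom X X')
    (e : ses Y X) (e' : ses Y' X') : Prop :=
  exists h : hom (mid e) (mid e'),
    h \c infl e = infl e' \c y /\ defl e' \c h = x \c defl e.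

(* Existence of a morphism of extensions that is the identity on Y and is x
   at the other end; the maps k are the induced maps between the objects at
   which the conflations are spliced. *)
Fixpoint yext_mor (n : nat) (Y X X' : E) (x : hom X X') :
    yext n Y X -> yext n Y X' -> Prop :=
  match n return yext n Y X -> yext n Y X' -> Prop with
  | 0 => fun e e' => ses_mor (idm Y) x e e'
  | m.+1 => fun e e' => exists k : hom (projT1 e) (projT1 e'),
      ses_mor k x (projT2 e).2 (projT2 e').2 /\
      yext_mor k (projT2 e).1 (projT2 e').1
  end.

Definition yoneda_equiv (n : nat) (Y X : E) :
    yext n Y X -> yext n Y X -> Prop :=
  clos_refl_sym_trans _ (@yext_mor n Y X X (idm X)).

(* Ext^i(X, Y) = 0 for i >= 1: the group of Yoneda classes of i-fold
   extensions has only one element.  Junk value for i = 0. *)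
Definition Ext_eq0 (i : nat) (X Y : E) : Prop :=
  forall e e' : yext i.-1 Y X, yoneda_equiv e e'.

Definition Ext_orthogonal (d : nat) (N : E -> Prop) : Prop :=
  (forall X, N X <->
    forall M, N M -> forall i, (1 <= i <= d - 1)%N -> Ext_eq0 i X M) /\
  (forall Y, N Y <->
    forall M, N M -> forall i, (1 <= i <= d - 1)%N -> Ext_eq0 i M Y).

Definition generating (N : E -> Prop) : Prop :=
  forall X, exists (K M : E) (f : hom K M) (g : hom M X),
    N M /\ conflation f g.

Definition cogenerating (N : E -> Prop) : Prop :=
  forall X, exists (M K : E) (f : hom X M) (g : hom M K),
    N M /\ conflation f g.

Definition cluster_tilting (d : nat) (N : E -> Prop) : Prop :=
  [/\ additive_subcat N, generating N, cogenerating N,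
      functorially_finite N & Ext_orthogonal d N].

End YonedaExt.

Section LinearMaps.
Variable R : pzRingType.

Lemma linear_ext (U V : lmodType R) (f g : {linear U -> V}) : f =1 g -> f = g.
Proof.
case: f g => [f [[f0] [fZ]]] [g [[g0] [gZ]]] /= fg.
have {}fg : f = g by apply: funext.
by case: g / fg in g0 gZ *; rewrite (Prop_irrelevance f0 g0)
  (Prop_irrelevance fZ gZ).
Qed.

Section Zmodule.
Variables U V : lmodType R.

HB.instance Definition _ := gen_eqMixin {linear U -> V}.
HB.instance Definition _ := gen_choiceMixin {linear U -> V}.

Definition lin_zero : {linear U -> V} := \0.
Definition lin_opp (f : {linear U -> V}) : {linear U -> V} := \- f.
Definition lin_add (f g : {linear U -> V}) : {linear U -> V} := f \+ g.

Fact lin_addA : associative lin_add.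
Proof. by move=> f g h; apply: linear_ext => x /=; rewrite addrA. Qed.
Fact lin_addC : commutative lin_add.
Proof. by move=> f g; apply: linear_ext => x /=; rewrite addrC. Qed.
Fact lin_add0 : left_id lin_zero lin_add.
Proof. by move=> f; apply: linear_ext => x /=; rewrite add0r. Qed.
Fact lin_addN : left_inverse lin_zero lin_opp lin_add.
Proof. by move=> f; apply: linear_ext => x /=; rewrite addNr. Qed.

HB.instance Definition _ := GRing.isZmodule.Build {linear U -> V}
  lin_addA lin_addC lin_add0 lin_addN.

End Zmodule.

Definition lin_comp (U V W : lmodType R) (g : {linear V -> W})
  (f : {linear U -> V}) : {linear U -> W} := g \o f.
Definition lin_id (U : lmodType R) : {linear U -> U} := idfun.

Definition short_exact (U V W : lmodType R) (f : {linear U -> V})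
    (g : {linear V -> W}) : Prop :=
  [/\ injective f, (forall w, exists v, g v = w)
    & forall v, g v = 0 <-> exists u, f u = v].

Definition fin_gen (U : lmodType R) : Prop :=
  exists (n : nat) (e : 'I_n -> U),
    forall u, exists c : 'I_n -> R, u = \sum_(i < n) c i *: e i.

Definition projective (P : lmodType R) : Prop :=
  forall (V W : lmodType R) (g : {linear V -> W}) (f : {linear P -> W}),
    (forall w, exists v, g v = w) -> exists h : {linear P -> V}, g \o h =1 f.

End LinearMaps.

Section Cokernel.
Variables (R : pzRingType) (U V : lmodType R) (f : {linear U -> V}).

Definition coker_rel (v w : V) : bool := `[< exists u, f u = v - w >].

Fact coker_rel_equiv : equiv_class_of coker_rel.
Proof.
split=> [v|v w|w v x]; first by apply/asboolP; exists 0; rewrite linear0 subrr.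
- by apply/asboolP/asboolP => -[u fu]; exists (- u); rewrite linearN fu opprB.
- move=> /asboolP[u fu] /asboolP[u' fu']; apply/asboolP; exists (u + u').
  by rewrite linearD fu fu' addrA subrK.
Qed.
Canonical coker_equiv := EquivRelPack coker_rel_equiv.
Canonical coker_encModRel := defaultEncModRel coker_rel.

Definition coker : Type := {eq_quot coker_rel}.
HB.instance Definition _ := Choice.on coker.
HB.instance Definition _ := EqQuotient.on coker.

Definition coker_pi (v : V) : coker := \pi_coker v.

Lemma coker_piP (v w : V) : coker_pi v = coker_pi w <-> exists u, f u = v - w.
Proof.
rewrite /coker_pi; split=> [/eqP|/asboolP h]; last by apply/eqP; rewrite eqmodE.
by rewrite eqmodE => /asboolP.
Qed.

Lemma coker_pi_surj (x : coker) : exists v, coker_pi v = x.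
Proof. by exists (repr x); rewrite /coker_pi reprK. Qed.

Definition coker_opp (x : coker) : coker := coker_pi (- repr x).
Definition coker_add (x y : coker) : coker := coker_pi (repr x + repr y).
Definition coker_scale (a : R) (x : coker) : coker := coker_pi (a *: repr x).

Lemma coker_repr v : exists u, f u = v - repr (coker_pi v).
Proof. by apply/coker_piP; rewrite /coker_pi reprK. Qed.

Lemma coker_piN v : coker_pi (- v) = coker_opp (coker_pi v).
Proof.
apply/coker_piP; have [u fu] := coker_repr v; exists (- u).
by rewrite linearN fu opprB opprK addrC.
Qed.

Lemma coker_piD v w : coker_pi (v + w) = coker_add (coker_pi v) (coker_pi w).
Proof.
apply/coker_piP; have [u fu] := coker_repr v; have [u' fu'] := coker_repr w.
by exists (u + u'); rewrite linearD fu fu' opprD addrACA.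
Qed.

Lemma coker_piZ a v : coker_pi (a *: v) = coker_scale a (coker_pi v).
Proof.
apply/coker_piP; have [u fu] := coker_repr v; exists (a *: u).
by rewrite linearZ /= fu scalerBr.
Qed.

Fact coker_addA : associative coker_add.
Proof.
move=> x y z; have [u <-] := coker_pi_surj x; have [v <-] := coker_pi_surj y.
by have [w <-] := coker_pi_surj z; rewrite -!coker_piD addrA.
Qed.
Fact coker_addC : commutative coker_add.
Proof.
move=> x y; have [u <-] := coker_pi_surj x; have [v <-] := coker_pi_surj y.
by rewrite -!coker_piD addrC.
Qed.
Fact coker_add0 : left_id (coker_pi 0) coker_add.
Proof.
by move=> x; have [u <-] := coker_pi_surj x; rewrite -coker_piD add0r.
Qed.
Fact coker_addN : left_inverse (coker_pi 0) coker_opp coker_add.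
Proof.
by move=> x; have [u <-] := coker_pi_surj x;
  rewrite -coker_piN -coker_piD addNr.
Qed.
HB.instance Definition _ := GRing.isZmodule.Build coker
  coker_addA coker_addC coker_add0 coker_addN.

Fact coker_scaleA a b x :
  coker_scale a (coker_scale b x) = coker_scale (a * b) x.
Proof. by have [v <-] := coker_pi_surj x; rewrite -!coker_piZ scalerA. Qed.
Fact coker_scale1 : left_id 1 coker_scale.
Proof.
by move=> x; have [v <-] := coker_pi_surj x; rewrite -!coker_piZ scale1r.
Qed.
Fact coker_scaleDr : right_distributive coker_scale +%R.
Proof.
move=> a x y; have [v <-] := coker_pi_surj x; have [w <-] := coker_pi_surj y.
by rewrite -[X in coker_scale a X]coker_piD -!coker_piZ scalerDr coker_piD.
Qed.
Fact coker_scaleDl x : {morph coker_scale^~ x : a b / a + b}.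
Proof.
by move=> a b; have [v <-] := coker_pi_surj x;
  rewrite -!coker_piZ scalerDl coker_piD.
Qed.
HB.instance Definition _ := GRing.Zmodule_isLmodule.Build R coker
  coker_scaleA coker_scale1 coker_scaleDr coker_scaleDl.

Fact coker_pi_additive : zmod_morphism coker_pi.
Proof. by move=> v w; rewrite coker_piD coker_piN. Qed.
HB.instance Definition _ :=
  GRing.isZmodMorphism.Build V coker coker_pi coker_pi_additive.
Fact coker_pi_scalable : scalable coker_pi.
Proof. exact: coker_piZ. Qed.
HB.instance Definition _ :=
  GRing.isScalable.Build R V coker _ coker_pi coker_pi_scalable.

Lemma coker_fin_gen : fin_gen V -> fin_gen coker.
Proof.
move=> [n [e ge]]; exists n, (coker_pi \o e) => x.
have [v <-] := coker_pi_surj x; have [c ->] := ge v; exists c.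
by rewrite linear_sum; apply: eq_bigr => i _; rewrite linearZ.
Qed.

End Cokernel.

Section ModuleCategory.
Variable R : pzRingType.

Record fgmod := FgMod {
  fgmod_sort :> lmodType R;
  fgmodP : fin_gen fgmod_sort }.

Definition fgmod_precat : precat.
Proof.
refine (@Precat fgmod (fun U V => {linear U -> V}) (fun U => lin_id U)
  (fun U V W g f => lin_comp g f) _ _ _ _ _).
- by move=> *; apply: linear_ext.
- by move=> *; apply: linear_ext.
- by move=> *; apply: linear_ext.
- by move=> *; apply: linear_ext.
- by move=> U V W g f f'; apply: linear_ext => x /=; rewrite raddfD.
Defined.

Definition fgmod_exact : exactData :=
  @ExactData fgmod_precat (fun U V W f g => short_exact f g).

(* Unlike in a general exact category, generation and cogeneration are not
   part of the definition for module categories. *)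
Definition cluster_tilting_mod (d : nat) (M : fgmod_exact -> Prop) : Prop :=
  [/\ additive_subcat M, functorially_finite M & Ext_orthogonal d M].

End ModuleCategory.

Section Complexes.
Variables (R : pzRingType) (d : nat).

(* Homological indexing: [term i] is the component in cohomological degree -i;
   the components in positive degrees are zero and omitted. *)
Record projcomplex := ProjComplex {
  term : nat -> fgmod R;
  diff : forall i, {linear term i.+1 -> term i};
  diff_diff : forall i x, diff i (diff i.+1 x) = 0;
  term_projective : forall i, projective (term i);
  term_bounded : forall i, (d < i)%N -> forall x : term i, x = 0 }.

Record chainmap (P Q : projcomplex) := ChainMap {
  chain : forall i, {linear term P i -> term Q i};
  chain_diff : forall i x, chain i (diff P i x) = diff Q i (chain i.+1 x) }.

Lemma chainmap_ext (P Q : projcomplex) (f g : chainmap P Q) :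
  (forall i, chain f i =1 chain g i) -> f = g.
Proof.
case: f g => [f fP] [g gP] /= fg.
have {}fg : f = g.
  by apply: functional_extensionality_dep => i; exact: linear_ext (fg i).
by case: g / fg in gP *; rewrite (Prop_irrelevance fP gP).
Qed.

Section Zmodule.
Variables P Q : projcomplex.

HB.instance Definition _ := gen_eqMixin (chainmap P Q).
HB.instance Definition _ := gen_choiceMixin (chainmap P Q).

Program Definition chain_zero : chainmap P Q := @ChainMap P Q (fun i => 0) _.
Next Obligation. by rewrite /= raddf0. Qed.
Program Definition chain_opp (f : chainmap P Q) : chainmap P Q :=
  @ChainMap P Q (fun i => - chain f i) _.
Next Obligation. by rewrite /= chain_diff raddfN. Qed.
Program Definition chain_add (f g : chainmap P Q) : chainmap P Q :=
  @ChainMap P Q (fun i => chain f i + chain g i) _.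
Next Obligation. by rewrite /= !chain_diff raddfD. Qed.

Fact chain_addA : associative chain_add.
Proof. by move=> f g h; apply: chainmap_ext => i x /=; rewrite addrA. Qed.
Fact chain_addC : commutative chain_add.
Proof. by move=> f g; apply: chainmap_ext => i x /=; rewrite addrC. Qed.
Fact chain_add0 : left_id chain_zero chain_add.
Proof. by move=> f; apply: chainmap_ext => i x /=; rewrite add0r. Qed.
Fact chain_addN : left_inverse chain_zero chain_opp chain_add.
Proof. by move=> f; apply: chainmap_ext => i x /=; rewrite addNr. Qed.
HB.instance Definition _ := GRing.isZmodule.Build (chainmap P Q)
  chain_addA chain_addC chain_add0 chain_addN.

End Zmodule.

Program Definition chain_id (P : projcomplex) : chainmap P P :=
  @ChainMap P P (fun i => lin_id (term P i)) _.
Program Definition chain_comp (P Q S : projcomplex) (g : chainmap Q S)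
    (f : chainmap P Q) : chainmap P S :=
  @ChainMap P S (fun i => lin_comp (chain g i) (chain f i)) _.
Next Obligation. by rewrite /= !chain_diff. Qed.

Definition projcomplex_precat : precat.
Proof.
refine (@Precat projcomplex (fun P Q => chainmap P Q)
  chain_id chain_comp _ _ _ _ _).
- by move=> *; apply: chainmap_ext.
- by move=> *; apply: chainmap_ext.
- by move=> *; apply: chainmap_ext.
- by move=> *; apply: chainmap_ext.
- by move=> P Q S g f f'; apply: chainmap_ext => i x /=; rewrite raddfD.
Defined.

Definition degreewise_split (P Q S : projcomplex) (f : chainmap P Q)
    (g : chainmap Q S) : Prop :=
  forall i, short_exact (chain f i) (chain g i) /\
    exists s : {linear term S i -> term Q i}, chain g i \o s =1 id.

Definition projcomplex_exact : exactData :=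
  @ExactData projcomplex_precat degreewise_split.

Definition H0 (P : projcomplex) : fgmod R :=
  FgMod (coker_fin_gen (diff P 0) (fgmodP (term P 0))).

(* The cycles in cohomological degree -i; the differential leaving degree 0
   is zero. *)
Definition cycle (P : projcomplex) (i : nat) : term P i -> Prop :=
  if i is j.+1 return term P i -> Prop
  then fun x => diff P j x = 0 else fun=> True.

(* H_{-i}(P) = 0 *)
Definition H_eq0 (P : projcomplex) (i : nat) : Prop :=
  forall x : term P i, cycle x -> exists y, diff P i y = x.

Definition Pd (M : fgmod R -> Prop) (P : projcomplex) : Prop :=
  M (H0 P) /\ forall i, (1 <= i <= d - 1)%N -> H_eq0 P i.

End Complexes.

Arguments Pd {R} d M P.

(* Main.v *)
From Pilot Require Import Defs.
From mathcomp Require Import all_boot all_order all_algebra all_field.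
From mathcomp Require Import boolp.
From HB Require Import structures.
From Stdlib Require Import Relation_Operators.
Import Pilot.Defs.

(** Let E be the exact category of complexes of projectives in degrees -d..0,
    and for a complex X and a module V let H^i(X, V) be the cohomology of
    Hom(X, V).  The proof translates every extension group in sight into
    these elementary cohomology groups.

    - If Y has no homology in degrees -1..-(d-1), then Ext^i_E(X, Y) = 0 if and
      only if H^i(X, H_0 Y) = 0 (ext_cpxP).  By dimension shifting along the
      canonical projective cover of X this is the case i = 1, where it says
      that a chain map from the syzygy of X to Y is null-homotopic as soon as
      it is so after composition with Y -> H_0 Y.
    - If X has no homology in degrees -1..-i, then X starts a projective
      resolution of H_0 X, so that H^i(X, V) = 0 if and only if
      Ext^i(H_0 X, V) = 0 in the module category (ext_modP).

    Hence between two complexes without inner homology the groups Ext^i_E,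
    0 < i < d, vanish exactly when those of the modules H_0 do.  Both
    orthogonality conditions on M thus carry over, provided that a complex
    orthogonal to the subcategory has no inner homology.  For X with
    H^i(X, M) = 0 this holds because every module embeds into a coinduced
    module Hom_k(A, k^n), which is injective and therefore lies in M
    (coker_embed_exact, embeds_in_coind).  On the other side it holds because
    the stalk complex of A in degree -d lies in the subcategory and its
    extensions by Y detect the homology of Y (ext_stalk).

    Every X is the target of a deflation from its projective cover
    X (+) X[-1] with twisted differential, and embeds into the dual object
    X (+) X[1]; both lie in the subcategory.  A left approximation of X adds
    to the second one a truncated resolution N of a left M-approximation of
    H_0 X: a map from X to a complex without inner homology which is zero on
    H_0 factors through the injective object (cocover_extend).  Right
    approximations are built from left ones by induction on m < d
    (approximation_tower): if C0 -> syzygy X is the object obtained for the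
    syzygy and C0 -> N -> C is a left approximation, then C0 -> syzygy X
    extends to N -> cover X and induces C -> X.  After d-1 steps C has
    become left orthogonal to the subcategory, hence belongs to it, and
    C (+) cover X -> X is a right approximation.

    Yoneda classes are handled by comparing an n-fold extension with a fixed
    projective resolution; the resulting cocycle is unique up to coboundaries
    and invariant under equivalence, which gives the usual criterion for the
    vanishing of Ext (ext_vanishing_of_resolution) without the Baer sum. *)

Set Implicit Arguments.
Unset Strict Implicit.
Unset Printing Implicit Defensive.

Import GRing.Theory.
Local Open Scope ring_scope.
Local Open Scope precat_scope.

(** * Preadditive categories *)

Section PrecatTheory.
Variable C : precat.

Lemma compm0 (X Y Z : C) (g : hom Y Z) : g \c (0 : hom X Y) = 0.
Proof. by apply: (addrI (g \c 0)); rewrite -compDr !addr0. Qed.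
Lemma comp0m (X Y Z : C) (f : hom X Y) : (0 : hom Y Z) \c f = 0.
Proof. by apply: (addrI (0 \c f)); rewrite -compDl !addr0. Qed.
Lemma compmN (X Y Z : C) (g : hom Y Z) (f : hom X Y) : g \c (- f) = - (g \c f).
Proof. by apply: (addrI (g \c f)); rewrite -compDr !subrr compm0. Qed.
Lemma compNm (X Y Z : C) (g : hom Y Z) (f : hom X Y) : (- g) \c f = - (g \c f).
Proof. by apply: (addrI (g \c f)); rewrite -compDl !subrr comp0m. Qed.
Lemma compmB (X Y Z : C) (g : hom Y Z) (f f' : hom X Y) :
  g \c (f - f') = g \c f - g \c f'.
Proof. by rewrite compDr compmN. Qed.
Lemma compBm (X Y Z : C) (g g' : hom Y Z) (f : hom X Y) :
  (g - g') \c f = g \c f - g' \c f.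
Proof. by rewrite compDl compNm. Qed.

End PrecatTheory.

(** * Vanishing of Yoneda extensions through projective resolutions *)

Section ExtVanishing.
Variable E : exactData.

Definition rel_projective (P : E) : Prop :=
  forall (Y X : E) (e : ses Y X) (f : hom P X),
    exists h : hom P (mid e), defl e \c h = f.

(** The consequences of the axioms of an exact category that the calculus of
    Yoneda extensions below relies on. *)
Record exact_with_projectives : Prop := ExactWithProjectives {
  ses_comp0 : forall (Y X : E) (e : ses Y X), defl e \c infl e = 0;
  infl_mono : forall (Y X : E) (e : ses Y X) W (u : hom W Y),
    infl e \c u = 0 -> u = 0;
  infl_ker : forall (Y X : E) (e : ses Y X) W (u : hom W (mid e)),
    defl e \c u = 0 -> exists t, infl e \c t = u;
  defl_coker : forall (Y X : E) (e : ses Y X) W (u : hom (mid e) W),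
    u \c infl e = 0 -> exists t, t \c defl e = u;
  defl_epi : forall (Y X : E) (e : ses Y X) W (u : hom X W),
    u \c defl e = 0 -> u = 0;
  ses_pullback : forall (Y X X' : E) (e : ses Y X) (x : hom X' X),
    exists e' : ses Y X', ses_mor (idm Y) x e' e;
  ses_pushout : forall (Y Y' X : E) (e : ses Y X) (y : hom Y Y'),
    exists e' : ses Y' X, ses_mor y (idm X) e e';
  enough_projectives : forall X : E,
    exists (K : E) (s : ses K X), rel_projective (mid s) }.

Hypothesis cat_exact : exact_with_projectives.

Definition splice n (Y K X : E) (b : yext n Y K) (s : ses K X) :
  yext n.+1 Y X := existT (fun K => (yext n Y K * ses K X)%type) K (b, s).

(** [cocycle_of s x e phi]: the map x lifts to a morphism from the resolution
    given by s to the extension e, and phi is the component of the lift at Y.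
    The lift is a chain of morphisms of conflations, one for each conflation of
    which e is spliced. *)
Fixpoint cocycle_of n (Y : E) (K : nat -> E)
    (s : forall i, ses (K i.+1) (K i)) (X' : E) (x : hom (K 0%N) X') :
    yext n Y X' -> hom (K n.+1) Y -> Prop :=
  match n return yext n Y X' -> hom (K n.+1) Y -> Prop with
  | 0 => fun e phi => ses_mor phi x (s 0%N) e
  | m.+1 => fun e phi => exists k : hom (K 1%N) (projT1 e),
      ses_mor k x (s 0%N) (projT2 e).2 /\
      cocycle_of (fun i => s i.+1) k (projT2 e).1 phi
  end.

Lemma ses_mor_refl (Y X : E) (e : ses Y X) : ses_mor (idm Y) (idm X) e e.
Proof. by exists (idm _); rewrite !comp1m !compm1. Qed.

Lemma ses_mor_comp (Y1 Y2 Y3 X1 X2 X3 : E) (y : hom Y1 Y2) (y' : hom Y2 Y3)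
    (x : hom X1 X2) (x' : hom X2 X3)
    (e1 : ses Y1 X1) (e2 : ses Y2 X2) (e3 : ses Y3 X3) :
  ses_mor y x e1 e2 -> ses_mor y' x' e2 e3 ->
  ses_mor (y' \c y) (x' \c x) e1 e3.
Proof.
move=> [h [h1 h2]] [h' [h1' h2']]; exists (h' \c h).
split; first by rewrite -compA h1 compA h1' compA.
by rewrite compA h2' -compA h2 compA.
Qed.

Lemma cocycle_of_mor n Y K s X1 X2 (x : hom (K 0%N) X1) (x' : hom X1 X2)
    (e1 : yext n Y X1) (e2 : yext n Y X2) phi :
  cocycle_of s x e1 phi -> yext_mor x' e1 e2 ->
  cocycle_of s (x' \c x) e2 phi.
Proof.
elim: n K s X1 X2 x x' e1 e2 phi => [|n IH] K s X1 X2 x x' e1 e2 phi /=.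
  by move=> h1 h2; have := ses_mor_comp h1 h2; rewrite comp1m.
move=> [k [h1 h2]] [l [h3 h4]]; exists (l \c k).
by split; [exact: ses_mor_comp h1 h3 | exact: IH h2 h4].
Qed.

(** The conflation whose deflation is the right end of the extension. *)
Definition last_ses n (Y X : E) : yext n Y X -> {K : E & ses K X} :=
  match n return yext n Y X -> {K : E & ses K X} with
  | 0 => fun e => existT _ Y e
  | m.+1 => fun e => existT _ (projT1 e) (projT2 e).2
  end.

(** Cocycles that differ by a coboundary: the difference extends along the
    inflation of the resolution. *)
Definition cohomologous n (Y : E) K (s : forall i, ses (K i.+1) (K i))
    (phi phi' : hom (K n.+1) Y) :=
  exists t : hom (mid (s n)) Y, t \c infl (s n) = phi - phi'.

(** Uniqueness of lifts up to homotopy.  For the induction it is stated for two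
    maps x, x' whose difference lifts to the last middle term of e: then the
    induced maps k, k' on kernels differ by a map through the next projective,
    and that map lifts again. *)
Lemma cocycle_of_unique n Y K s X' (x x' : hom (K 0%N) X') (e : yext n Y X')
    phi phi' :
  (forall i, rel_projective (mid (s i))) ->
  (exists u, defl (projT2 (last_ses e)) \c u = x - x') ->
  cocycle_of s x e phi -> cocycle_of s x' e phi' -> cohomologous s phi phi'.
Proof.
have step (L Y1 K0 X1 : E) (r : ses L K0) (a : ses Y1 X1) (y y' : hom K0 X1)
    (k k' : hom L Y1) (u : hom K0 (mid a)) : defl a \c u = y - y' ->
    ses_mor k y r a -> ses_mor k' y' r a ->
    exists t : hom (mid r) Y1, t \c infl r = k - k'.
  move=> hu [h [h1 h2]] [h' [h1' h2']].
  have [|t ht] := infl_ker cat_exact (e := a) (u := h - h' - u \c defl r).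
    by rewrite !compmB compA hu h2 h2' compBm subrr.
  exists t; apply/eqP; rewrite -subr_eq0;
    apply/eqP/(infl_mono cat_exact (e := a)).
  rewrite compmB compA ht !compBm compmB -compA (ses_comp0 cat_exact) compm0
    subr0.
  by rewrite h1 h1' subrr.
elim: n K s X' x x' e phi phi' => [|n IH] K s X' x x' e phi phi' hs [u hu] /=.
  exact: step hu.
move=> [k [h1 h2]] [k' [h1' h2']].
have [t ht] := step _ _ _ _ _ _ _ _ _ _ _ hu h1 h1'.
apply: (IH _ (fun i => s i.+1) _ _ _ _ _ _ _ _ h2 h2') => //.
case: (last_ses (projT2 e).1) => L a /=.
have [t' ht'] := hs 0%N _ _ a t.
by exists (t' \c infl (s 0%N)); rewrite compA ht'.
Qed.

(** Splice the pushout of the last conflation of the resolution along phi with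
    the other ones. *)
Lemma cocycle_of_realize n (Y : E) K (s : forall i, ses (K i.+1) (K i))
    (phi : hom (K n.+1) Y) :
  exists e : yext n Y (K 0%N), cocycle_of s (idm _) e phi.
Proof.
elim: n K s phi => [|n IH] K s phi; first exact: ses_pushout.
have [e he] := IH (fun i => K i.+1) (fun i => s i.+1) phi.
exists (splice e (s 0%N)); exists (idm _); split=> //.
exact: ses_mor_refl.
Qed.

Lemma cocycle_of_exists n Y K s X' (x : hom (K 0%N) X') (e : yext n Y X') :
  (forall i, rel_projective (mid (s i))) ->
  exists phi, cocycle_of s x e phi.
Proof.
have step (L Y1 K0 X1 : E) (r : ses L K0) (a : ses Y1 X1) (y : hom K0 X1) :
    rel_projective (mid r) -> exists k, ses_mor k y r a.
  move=> hr; have [h hh] := hr _ _ a (y \c defl r).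
  have [|k hk] := infl_ker cat_exact (e := a) (u := h \c infl r).
    by rewrite compA hh -compA (ses_comp0 cat_exact) compm0.
  by exists k, h.
elim: n K s X' x e => [|n IH] K s X' x e hs; first exact: step.
have [k hk] := step _ _ _ _ (s 0%N) (projT2 e).2 x (hs 0%N).
have [phi hphi] := IH (fun i => K i.+1) (fun i => s i.+1) _ k (projT2 e).1
  (fun i => hs i.+1).
by exists phi, k.
Qed.

Lemma yoneda_equiv_cohomologous n Y K s (e e' : yext n Y (K 0%N)) phi phi' :
  (forall i, rel_projective (mid (s i))) -> yoneda_equiv e e' ->
  cocycle_of s (idm _) e phi -> cocycle_of s (idm _) e' phi' ->
  cohomologous s phi phi'.
Proof.
move=> hs hee; have uniq (a : yext n Y (K 0%N)) f f' :
    cocycle_of s (idm _) a f -> cocycle_of s (idm _) a f' ->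
    cohomologous s f f'.
  by move=> h h'; apply: cocycle_of_unique h h' => //; exists 0;
    rewrite compm0 subrr.
elim: hee phi phi' => {e e'} [e e' m|e|e e' _ IH|a b c _ IH1 _ IH2] f f' h h'.
- by apply: (uniq e') => //; rewrite -[idm _]compm1; exact: cocycle_of_mor h m.
- exact: uniq h h'.
- have [t ht] := IH _ _ h' h.
  by exists (- t); rewrite compNm ht opprB.
- have [g hg] := cocycle_of_exists (idm _) b hs.
  have [[t ht] [t' ht']] := (IH1 _ _ h hg, IH2 _ _ hg h').
  by exists (t + t'); rewrite compDl ht ht' addrA subrK.
Qed.

Lemma yext_mor_refl n (Y X : E) (e : yext n Y X) : yext_mor (idm X) e e.
Proof.
elim: n X e => [|n IH] X e; first exact: ses_mor_refl.
by exists (idm _); split; [exact: ses_mor_refl | exact: IH].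
Qed.

Lemma yext_pullback n (Y X X' : E) (x : hom X X') (e : yext n Y X') :
  exists e' : yext n Y X, yext_mor x e' e.
Proof.
case: n e => [|n] e; first exact: ses_pullback.
have [a ha] := ses_pullback cat_exact (projT2 e).2 x.
exists (splice (projT2 e).1 a); exists (idm _); split=> //=.
exact: yext_mor_refl.
Qed.

(** Both extensions are identified with the direct sum, the first by its
    retraction and the second by the section complementary to its retraction. *)
Lemma split_ses_equiv (Y X : E) (e e' : ses Y X) :
  (exists r, r \c infl e = idm Y) ->
  (exists r, r \c infl e' = idm Y) -> ses_mor (idm Y) (idm X) e e'.
Proof.
move=> [r hr] [r' hr'].
have [|sg hsg] := defl_coker cat_exact (e := e') (u := idm _ - infl e' \c r').
  by rewrite compBm comp1m -compA hr' compm1 subrr.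
exists (infl e' \c r + sg \c defl e); split.
  by rewrite compDl -!compA hr (ses_comp0 cat_exact) compm0 addr0.
rewrite compDr !compA (ses_comp0 cat_exact) comp0m add0r.
suff -> : defl e' \c sg = idm X by [].
apply/eqP; rewrite -subr_eq0; apply/eqP/(defl_epi cat_exact (e := e')).
by rewrite compBm -compA hsg compmB compm1 comp1m compA (ses_comp0 cat_exact)
  comp0m
  subr0 subrr.
Qed.

(** If all extensions are equivalent, then in particular the one realising phi
    is equivalent to the one realising 0, so that phi is a coboundary.
    Conversely, if every cocycle is a coboundary, then the one-fold extensions
    split, and an (n+1)-fold extension is the target of a morphism from a
    splice of an n-fold extension with the first conflation of the resolution,
    obtained by pulling back; this reduces the claim to n. *)
Lemma ext_vanishing_of_resolution n (Y : E) K
    (s : forall i, ses (K i.+1) (K i)) :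
  (forall i, rel_projective (mid (s i))) ->
  Ext_eq0 n.+1 (K 0%N) Y <->
  forall phi : hom (K n.+1) Y, exists t, t \c infl (s n) = phi.
Proof.
move=> hs; split=> [h0 phi|].
  have [e he] := cocycle_of_realize s phi.
  have [e0 he0] := cocycle_of_realize s (0 : hom (K n.+1) Y).
  have [t ht] := yoneda_equiv_cohomologous hs (h0 e e0) he he0.
  by exists t; rewrite ht subr0.
elim: n K s hs => [|n IH] K s hs h e e'.
  have splits (a : ses Y (K 0%N)) : exists r, r \c infl a = idm Y.
    have [phi [l [l1 l2]]] := cocycle_of_exists (idm _) (a : yext 0 Y _) hs.
    have [t ht] := h phi.
    have [|r hr] := defl_coker cat_exact (e := s 0%N) (u := l - infl a \c t).
      by rewrite compBm l1 -compA ht subrr.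
    have hsec : defl a \c r = idm _.
      apply/eqP; rewrite -subr_eq0; apply/eqP/(defl_epi cat_exact (e := s 0%N)).
      rewrite compBm -compA hr compmB compA (ses_comp0 cat_exact) comp0m subr0
        l2.
      by rewrite subrr.
    have [|q hq] := infl_ker cat_exact (e := a) (u := idm _ - r \c defl a).
      by rewrite compmB compm1 compA hsec comp1m subrr.
    exists q; apply/eqP; rewrite -subr_eq0;
      apply/eqP/(infl_mono cat_exact (e := a)).
    by rewrite compmB compA hq compBm comp1m -compA (ses_comp0 cat_exact)
      !compm0 compm1
      subr0 subrr.
  by apply: rst_step; exact: split_ses_equiv.
(* Every extension receives a morphism from one that ends in s 0. *)
have std (a : yext n.+1 Y (K 0%N)) : exists b : yext n Y (K 1%N),
    yext_mor (idm (K 0%N)) (splice b (s 0%N)) a.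
  have [h' hh'] := hs 0%N _ _ (projT2 a).2 (defl (s 0%N)).
  have [|k hk] := infl_ker cat_exact (e := (projT2 a).2)
    (u := h' \c infl (s 0%N)).
    by rewrite compA hh' (ses_comp0 cat_exact).
  have [b hb] := yext_pullback k (projT2 a).1.
  by exists b, k; split=> //; exists h'; rewrite comp1m.
have [[b hb] [b' hb']] := (std e, std e').
apply: (rst_trans _ _ _ (splice b (s 0%N))).
  exact/rst_sym/rst_step.
apply: (rst_trans _ _ _ (splice b' (s 0%N)));
  last exact: rst_step.
have := IH (fun i => K i.+1) (fun i => s i.+1) (fun i => hs i.+1) h b b'.
elim=> {hb hb'} {b b'} [b b' hb|b|b b' _ hb|b b' b'' _ hb _ hb'].
- by apply: rst_step; exists (idm _); split=> //; exact: ses_mor_refl.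
- exact: rst_refl.
- exact: rst_sym.
- exact: rst_trans hb hb'.
Qed.

Section DimensionShift.
Variables (K X : E) (s : ses K X).
Hypothesis proj_s : rel_projective (mid s).

Let syz (Z : E) : E := projT1 (cid (enough_projectives cat_exact Z)).
Let syz_ses (Z : E) : ses (syz Z) Z :=
  projT1 (cid (projT2 (cid (enough_projectives cat_exact Z)))).
Let syz_proj (Z : E) : rel_projective (mid (syz_ses Z)).
Proof. exact: projT2 (cid (projT2 (cid (enough_projectives cat_exact Z)))). Qed.

Let res (i : nat) : E := if i is j.+1 then iter j syz K else X.
Let res_ses (i : nat) : ses (res i.+1) (res i) :=
  match i return ses (res i.+1) (res i) with
  | 0 => s
  | j.+1 => syz_ses (iter j syz K)
  end.
Let res_proj i : rel_projective (mid (res_ses i)).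
Proof. by case: i => [|i] //; exact: syz_proj. Qed.

Lemma ext1_eq0P (Y : E) :
  Ext_eq0 1 X Y <-> forall phi : hom K Y, exists t, t \c infl s = phi.
Proof. exact: (ext_vanishing_of_resolution 0%N Y res_proj). Qed.

Lemma ext_dimension_shift n (Y : E) : Ext_eq0 n.+2 X Y <-> Ext_eq0 n.+1 K Y.
Proof.
apply: iff_trans (ext_vanishing_of_resolution n.+1 Y res_proj) _.
apply: iff_sym.
exact: (@ext_vanishing_of_resolution n Y (fun i => res i.+1)
  (fun i => res_ses i.+1) (fun i => @res_proj i.+1)).
Qed.

End DimensionShift.

End ExtVanishing.

(** * Linear maps, kernels and finitely generated modules *)

Section Linear.
Variable R : pzRingType.
Implicit Types U V W : lmodType R.

Definition pack_linear U V (f : U -> V) (hf : linear f) : {linear U -> V} :=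
  HB.pack f (GRing.isLinear.Build R U V *:%R f hf).

(** Maps are obtained below by solving equations pointwise; a functional
    relation that is a submodule is the graph of a linear map. *)
Lemma linear_of_graph W V (G : W -> V -> Prop) :
  (forall w, exists v, G w v) ->
  (forall w v v', G w v -> G w v' -> v = v') ->
  (forall a w w' v v', G w v -> G w' v' -> G (a *: w + w') (a *: v + v')) ->
  exists f : {linear W -> V}, forall w, G w (f w).
Proof.
move=> tot uniq lin; pose f w := projT1 (cid (tot w)).
have fP w : G w (f w) := projT2 (cid (tot w)).
have hf : linear f.
  by move=> a w w'; apply: (uniq (a *: w + w')); [exact: fP | exact: lin].
by exists (pack_linear hf).
Qed.

Lemma factor_inj U V W (f : {linear U -> V}) (h : {linear W -> V}) :
  injective f -> (forall w, exists u, f u = h w) ->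
  exists t : {linear W -> U}, forall w, f (t w) = h w.
Proof.
move=> injf ex; apply: (@linear_of_graph W U (fun w u => f u = h w)) => //.
- by move=> w v v' hv hv'; apply: injf; rewrite hv hv'.
- by move=> a w w' v v' hv hv'; rewrite !linearP hv hv'.
Qed.

Lemma factor_surj U V W (g : {linear V -> W}) (h : {linear V -> U}) :
  (forall w, exists v, g v = w) -> (forall v, g v = 0 -> h v = 0) ->
  exists t : {linear W -> U}, forall v, t (g v) = h v.
Proof.
move=> surj ker.
have [|||t ht] :=
  @linear_of_graph W U (fun w u => exists2 v, g v = w & h v = u).
- by move=> w; have [v hv] := surj w; exists (h v), v.
- move=> w u u' [x hx <-] [y hy <-]; apply/eqP.
  by rewrite -subr_eq0 -linearB /= ker // linearB /= hx hy subrr.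
- move=> a w w' u u' [x <- <-] [y <- <-].
  by exists (a *: x + y); rewrite !linearP.
exists t => v; have [x hx <-] := ht (g v); apply/eqP.
by rewrite -subr_eq0 -linearB /= ker // linearB /= hx subrr.
Qed.

Lemma inj_of_ker U V (f : {linear U -> V}) :
  (forall u, f u = 0 -> u = 0) -> injective f.
Proof. by move=> h u v e; apply/subr0_eq/h; rewrite linearB /= e subrr. Qed.

Section Kernel.
Variables (U V : lmodType R) (f : {linear U -> V}).

Definition ker_pred : {pred U} := fun u => f u == 0.
Fact ker_submod : submod_closed ker_pred.
Proof.
split=> [|a u v]; first by rewrite /ker_pred unfold_in linear0.
by rewrite /ker_pred !unfold_in => /eqP hu /eqP hv; rewrite linearP hu hv
  scaler0 addr0.
Qed.
HB.instance Definition _ := GRing.isSubmodClosed.Build R U ker_pred ker_submod.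

Record kernel := Kernel { kernel_val : U; _ : kernel_val \in ker_pred }.
HB.instance Definition _ := [isSub for kernel_val].
HB.instance Definition _ := [Choice of kernel by <:].
HB.instance Definition _ := [SubChoice_isSubLmodule of kernel by <:].

Definition kernel_incl : {linear kernel -> U} := \val.

Lemma kernel_incl_inj : injective kernel_incl.
Proof. exact: val_inj. Qed.
Lemma kernel_inclP (x : kernel) : f (kernel_incl x) = 0.
Proof. exact/eqP/(valP x). Qed.
Lemma kernel_ex u : f u = 0 -> exists x, kernel_incl x = u.
Proof. by move/eqP=> hu; exists (Kernel (hu : u \in ker_pred)). Qed.
End Kernel.

Lemma fin_gen_of_fintype U (I : finType) (e : I -> U) :
  (forall u, exists c : I -> R, u = \sum_i c i *: e i) -> fin_gen U.
Proof.
move=> he; exists #|I|, (e \o enum_val) => u; have [c ->] := he u.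
exists (c \o enum_val).
by rewrite (reindex (@enum_val I (mem I))) //; exact/onW_bij/enum_val_bij.
Qed.

(** This makes pullbacks and pushouts of conflations finitely generated over
    any ring. *)
Lemma fin_gen_ext U V W (f : {linear U -> V}) (g : {linear V -> W}) :
  short_exact f g -> fin_gen U -> fin_gen W -> fin_gen V.
Proof.
move=> [_ gs ex] [n [e he]] [m [e' he']].
have [e2 he2] := choice (fun j => gs (e' j)).
apply: (@fin_gen_of_fintype V ('I_n + 'I_m)%type
  (fun i => match i with inl i => f (e i) | inr j => e2 j end)) => v.
have [b hb] := he' (g v).
have [|u hu] := (ex (v - \sum_j b j *: e2 j)).1.
  rewrite linearB linear_sum /= hb; apply/eqP; rewrite subr_eq0; apply/eqP.
  by apply: eq_bigr => j _; rewrite linearZ /= he2.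
have [c hc] := he u.
exists (fun i => match i with inl i => c i | inr j => b j end).
rewrite big_sumType /= -[v in LHS](subrK (\sum_j b j *: e2 j)) -hu hc;
  congr +%R.
by rewrite linear_sum; apply: eq_bigr => i _; rewrite linearZ.
Qed.

(** A projective module lifts along g even when g is not surjective, as long as
    the image of f is contained in that of g: lift the identity along the
    projection of the pullback of g and f, which is surjective. *)
Lemma projective_lift U V (P : lmodType R) (g : {linear U -> V})
    (f : {linear P -> V}) :
  projective P -> (forall x, exists u, g u = f x) ->
  exists h : {linear P -> U}, forall x, g (h x) = f x.
Proof.
move=> hP ex.
pose q : {linear (U * P)%type -> V} := (g \o fst) \- (f \o snd).
pose K := kernel q.
have [x|h hh] := hP K P (snd \o kernel_incl _) idfun.
  have [u hu] := ex x; have [|z hz] := @kernel_ex _ _ q (u, x).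
    by rewrite /= hu subrr.
  by exists z; exact: (congr1 snd hz).
exists (fst \o kernel_incl _ \o h) => x /=.
have e : g (kernel_incl q (h x)).1 = f (kernel_incl q (h x)).2.
  exact/subr0_eq/(kernel_inclP (h x)).
by rewrite [LHS]e; congr (f _); exact: hh.
Qed.

Section Injections.
Variables U V : lmodType R.
Fact pair_l_linear : linear (fun u : U => (u, 0 : V)).
Proof.
by move=> a u u'; rewrite -[RHS]/(a *: u + u', a *: 0 + 0) scaler0 addr0.
Qed.
Fact pair_r_linear : linear (fun v : V => (0 : U, v)).
Proof.
by move=> a u u'; rewrite -[RHS]/(a *: 0 + 0, a *: u + u') scaler0 addr0.
Qed.
Definition pair_l : {linear U -> (U * V)%type} := pack_linear pair_l_linear.
Definition pair_r : {linear V -> (U * V)%type} := pack_linear pair_r_linear.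
Lemma pair_lr (z : U * V) : z = pair_l z.1 + pair_r z.2.
Proof.
by case: z => u v; rewrite -[RHS]/(u + 0, 0 + v) addr0 add0r.
Qed.
End Injections.

Lemma projective_prod U V : projective U -> projective V ->
  projective (U * V)%type.
Proof.
move=> hU hV W W' g f gs.
have [h hh] := hU _ _ g (f \o pair_l U V) gs.
have [h' hh'] := hV _ _ g (f \o pair_r U V) gs.
exists ((h \o fst) \+ (h' \o snd)) => z /=.
have e : g (h z.1) = f (pair_l _ _ z.1) := hh _.
have e' : g (h' z.2) = f (pair_r _ _ z.2) := hh' _.
by rewrite linearD e e' -linearD -pair_lr.
Qed.

Lemma fin_gen_prod U V : fin_gen U -> fin_gen V -> fin_gen (U * V)%type.
Proof.
apply: (@fin_gen_ext _ _ _ (pair_l U V) snd); split.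
- by move=> u u' [].
- by move=> v; exists (0, v).
- by move=> [u v] /=; split=> [->|[u' [_ <-]] //]; exists u.
Qed.

Lemma free_projective n : projective 'rV[R]_n.
Proof.
move=> V W g f gs; have [e he] := choice (fun j => gs (f (delta_mx 0 j))).
have lin : linear (fun x : 'rV[R]_n => \sum_j x 0 j *: e j).
  move=> a x y; rewrite scaler_sumr -big_split; apply: eq_bigr => j _.
  by rewrite !mxE scalerDl scalerA.
exists (pack_linear lin) => x /=; rewrite linear_sum [in RHS](row_sum_delta x)
  linear_sum.
by apply: eq_bigr => j _; rewrite !linearZ /= he.
Qed.

Lemma fin_gen_free n : fin_gen 'rV[R]_n.
Proof.
by exists n, (delta_mx 0) => u; exists (u 0); rewrite [u in LHS]row_sum_delta.
Qed.

Lemma free_cover U : fin_gen U -> exists n (g : {linear 'rV[R]_n -> U}),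
  forall u, exists v, g v = u.
Proof.
move=> [n [e he]].
have lin : linear (fun x : 'rV[R]_n => \sum_j x 0 j *: e j).
  move=> a x y; rewrite scaler_sumr -big_split; apply: eq_bigr => j _.
  by rewrite !mxE scalerDl scalerA.
exists n, (pack_linear lin) => u; have [c ->] := he u;
  exists (\row_j c j) => /=.
by apply: eq_bigr => j _; rewrite mxE.
Qed.

End Linear.

(** * The exact category of finitely generated modules *)

Section FgModules.
Variable R : pzRingType.

Definition fg_prod (U V : fgmod R) : fgmod R :=
  FgMod (fin_gen_prod (fgmodP U) (fgmodP V)).

Definition fg_zero : fgmod R := FgMod (fin_gen_free R 0).

Lemma fg_zero_eq (x y : fg_zero) : x = y.
Proof. by rewrite (thinmx0 (x : 'rV[R]_0)) (thinmx0 (y : 'rV[R]_0)). Qed.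

(** Truncation of families of modules: U when b holds and zero otherwise.  The
    maps [to_if] and [of_if] spare any transport along equalities of terms. *)
Definition fg_if (b : bool) (U : fgmod R) : fgmod R := if b then U else fg_zero.

Definition to_if b (U : fgmod R) : {linear U -> fg_if b U} :=
  if b return {linear U -> fg_if b U} then lin_id U else 0.
Definition of_if b (U : fgmod R) : {linear fg_if b U -> U} :=
  if b return {linear fg_if b U -> U} then lin_id U else 0.

Lemma to_ifK (b : bool) (U : fgmod R) x : b -> of_if b U (to_if b U x) = x.
Proof. by case: b. Qed.
Lemma of_ifK (b : bool) (U : fgmod R) : cancel (of_if b U) (to_if b U).
Proof. by case: b => // x; exact: fg_zero_eq. Qed.
Lemma fg_if_false b (U : fgmod R) (x : fg_if b U) : ~~ b -> x = 0.
Proof. by case: b x => // x _; exact: fg_zero_eq. Qed.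
Lemma fg_if_projective b (U : fgmod R) : projective U -> projective (fg_if b U).
Proof. by case: b => // _; exact: free_projective. Qed.

Hypothesis noetherian : forall (U V : fgmod R) (f : {linear U -> V}),
  fin_gen (kernel f).

(** Only the existence of enough projectives uses that submodules of finitely
    generated modules are finitely generated. *)
Lemma fgmod_exact_with_projectives : exact_with_projectives (fgmod_exact R).
Proof.
split.
- move=> Y X [Z f g [injf surg ex]]; apply: linear_ext => x /=.
  by apply/(ex (f x)); exists x.
- move=> Y X [Z f g [/= injf surg ex]] W u hu; apply: linear_ext => x /=.
  apply: injf; rewrite linear0; exact:
    (congr1 (fun h : {linear W -> Z} => h x) hu).
- move=> Y X [Z f g [/= injf surg ex]] W u hu.
  have [|t ht] := @factor_inj _ _ _ _ f u injf.
    by move=> w; apply/ex; exact: (congr1 (fun h : {linear W -> X} => h w) hu).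
  by exists t; apply: linear_ext.
- move=> Y X [Z f g [/= injf surg ex]] W u hu.
  have [|t ht] := @factor_surj _ _ _ _ g u surg.
    move=> v /ex [y <-]; exact: (congr1 (fun h : {linear Y -> W} => h y) hu).
  by exists t; apply: linear_ext.
- move=> Y X [Z f g [/= injf surg ex]] W u hu; apply: linear_ext => x /=.
  have [v <-] := surg x.
  exact: (congr1 (fun h : {linear Z -> W} => h v) hu).
- move=> Y X X' [Z f g [/= injf surg ex]] x.
  pose q : {linear (Z * X')%type -> X} := (g \o fst) \- (x \o snd).
  have [|i hi] := @factor_inj _ _ _ _ (@kernel_incl _ _ _ q) (pair_l Z X' \o f)
    (@kernel_incl_inj _ _ _ _).
    move=> y; apply: kernel_ex; rewrite /= linear0 subr0; apply/ex; by exists y.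
  pose p : {linear kernel q -> X'} := snd \o @kernel_incl _ _ _ q.
  have se : short_exact i p.
    split.
    - by move=> y y' h; apply: injf; have := hi y; rewrite h hi => -[].
    - move=> x'; have [z hz] := surg (x x').
      have [|k hk] := @kernel_ex _ _ _ q (z, x').
        by rewrite /= hz subrr.
      by exists k; exact: (congr1 snd hk).
    - move=> k; have := kernel_inclP k.
      move=> H; split=> [hk|[y <-]]; last exact: (congr1 snd (hi y)).
      have e : g (kernel_incl q k).1 = x (p k) := subr0_eq H.
      move: e; rewrite hk linear0 => /ex [y hy].
      exists y; apply: kernel_incl_inj; rewrite hi /= hy.
      by rewrite [RHS]surjective_pairing; congr (_, _).
  exists (@Ses (fgmod_exact R) Y X' (FgMod
    (fin_gen_ext se (fgmodP Y) (fgmodP X'))) i p se).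
  exists (fst \o kernel_incl q : {linear kernel q -> Z}); split.
    by apply: linear_ext => y; exact: (congr1 fst (hi y)).
  by apply: linear_ext => k; exact/subr0_eq/(kernel_inclP k).
- move=> Y Y' X [Z f g [/= injf surg ex]] y.
  pose j : {linear Y -> (Z * Y')%type} :=
    (pair_l Z Y' \o f) \- (pair_r Z Y' \o y).
  have jE w : j w = (f w, - y w).
    by rewrite -[LHS]/(f w - 0, 0 - y w) subr0 sub0r.
  have [|p hp] := @factor_surj _ _ _ _ (coker_pi j) (g \o fst)
    (@coker_pi_surj _ _ _ j).
    move=> z hz; have [|w] := (coker_piP j z 0).1; first by rewrite hz linear0.
    rewrite subr0 jE => <- /=; apply/ex; by exists w.
  pose i : {linear Y' -> coker j} := coker_pi j \o pair_r Z Y'.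
  have se : short_exact i p.
    split.
    - move=> u u' /(coker_piP j)[w]; rewrite jE => e.
      have hf : f w = 0 - 0 := congr1 fst e.
      have hy : - y w = u - u' := congr1 snd e.
      have w0 : w = 0 by apply: injf; rewrite hf subrr linear0.
      by apply/subr0_eq; rewrite -hy w0 linear0 oppr0.
    - move=> x; have [z <-] := surg x; exists (coker_pi j (z, 0)); exact: hp.
    - move=> c; have [[z u] <-] := coker_pi_surj c; rewrite hp /=.
      split=> [/ex [w hw]|[u' /(coker_piP j)[w]]].
        exists (u + y w); apply/(coker_piP j); exists (- w).
        rewrite jE !linearN opprK hw -[RHS]/(0 - z, u + y w - u) sub0r.
        by rewrite addrC addKr.
      rewrite jE => /(congr1 fst) hf; apply/ex; exists (- w).
      have {}hf : f w = 0 - z := hf.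
      by rewrite linearN hf sub0r opprK.
  exists (@Ses (fgmod_exact R) Y' X
    (FgMod (fin_gen_ext se (fgmodP Y') (fgmodP X))) i p se).
  exists (coker_pi j \o pair_l Z Y' : {linear Z -> coker j}); split.
    apply: linear_ext => w; apply/(coker_piP j); exists w.
    by rewrite jE -[RHS]/(f w - 0, 0 - y w) subr0 sub0r.
  by apply: linear_ext => z; exact: hp.
- move=> X; have [n [g gs]] := free_cover (fgmodP X).
  pose F := FgMod (fin_gen_free R n).
  have se : short_exact (kernel_incl g) g.
    split=> // [|v]; first exact: kernel_incl_inj.
    by split=> [/kernel_ex //|[x <-]]; exact: kernel_inclP.
  exists (FgMod (noetherian (g : {linear F -> X}))).
  exists (@Ses (fgmod_exact R) (FgMod (noetherian (g : {linear F -> X}))) X F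
    (kernel_incl g) g se).
  move=> Y Z [V f h [/= injf sur ex]] a.
  have [b hb] := @free_projective _ n _ _ h a sur.
  by exists b; apply: linear_ext => x; exact: hb.
Qed.

End FgModules.

(** * Modules over a finite-dimensional algebra *)

Section FiniteDimensionalAlgebra.
Variables (k : fieldType) (A : falgType k).
Notation R := (A^c).

(** The structure map of the algebra has central image, so it is a ring morphism
    to the converse ring as well. *)
Definition kscalar (c : k) : R := (c%:A : A).

Lemma kscalarM c d : kscalar (c * d) = kscalar c * kscalar d.
Proof.
rewrite /kscalar -[RHS]/(((d%:A : A) * c%:A)%R : A).
by rewrite -scalerAl mul1r scalerA mulrC.
Qed.

Lemma kscalarE c (b : A) : (c *: b : A) = kscalar c * (b : R).
Proof. by rewrite -[RHS]/((b : A) * c%:A) -scalerAr mulr1. Qed.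

(** Restriction of scalars to k: a copy of U carrying its k-linear structure. *)
Definition kmod (U : lmodType R) : Type := U.

Section KModule.
Variable U : lmodType R.
HB.instance Definition _ := GRing.Zmodule.on (kmod U).
Definition kscale (c : k) (u : kmod U) : kmod U := kscalar c *: (u : U).
Fact kscaleA a b u : kscale a (kscale b u) = kscale (a * b) u.
Proof. by rewrite /kscale scalerA kscalarM. Qed.
Fact kscale1 : left_id 1 kscale.
Proof. by move=> u; rewrite /kscale /kscalar scale1r -[RHS](@scale1r R U). Qed.
Fact kscaleDr : right_distributive kscale +%R.
Proof. by move=> a u v; rewrite /kscale -scalerDr. Qed.
Fact kscaleDl u : {morph kscale^~ u : a b / a + b}.
Proof. by move=> a b; rewrite /kscale /kscalar !scalerDl -(@scalerDl R U). Qed.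
HB.instance Definition _ := GRing.Zmodule_isLmodule.Build k (kmod U)
  kscaleA kscale1 kscaleDr kscaleDl.
End KModule.

Section RestrictScalars.
Variables (U V : lmodType R) (f : {linear U -> V}).
Definition klin_fun : kmod U -> kmod V := f.
Fact klin_linear : linear klin_fun.
Proof. by move=> a u v; exact: (linearP f (kscalar a) u v). Qed.
Definition klin : {linear kmod U -> kmod V} :=
  HB.pack klin_fun (GRing.isLinear.Build k (kmod U) (kmod V) *:%R klin_fun
    klin_linear).
End RestrictScalars.

(** The products of module generators with a k-basis of A. *)
Lemma fin_gen_kmod (U : lmodType R) : fin_gen U -> fin_gen (kmod U).
Proof.
move=> [n [e he]]; pose b := vbasis {:A}.
apply: (@fin_gen_of_fintype k (kmod U) ('I_n * 'I_(\dim {:A}))%type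
  (fun p => (b`_p.2 : R) *: (e p.1 : U) : kmod U)) => u.
have [c ->] := he u; exists (fun p => coord b p.2 (c p.1)).
rewrite -(pair_big xpredT xpredT (fun i j => coord b j (c i) *:
  ((b`_j : R) *: (e i : U) : kmod U))) /=; apply: eq_bigr => i _.
rewrite {1}(coord_vbasis (memvf (c i : A))).
rewrite -[LHS]/((\sum_j (coord b j (c i) *: b`_j : R)) *: e i) scaler_suml.
apply: eq_bigr => j _; rewrite -[RHS]/(kscalar _ *: (_ *: e i)) scalerA.
exact: (congr1 (fun r : R => r *: (e i : U)) (kscalarE _ _)).
Qed.

(** A k-linear surjection from k^n onto U with n minimal is injective: a
    nonzero vector x of the kernel, with entry j nonzero, can be used to
    correct every vector to one whose entry j is zero, so n - 1 coordinates
    would suffice. *)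
Lemma k_coordinates (U : fgmod R) :
  exists n (l : {linear kmod U -> 'rV[k]_n}) (m : {linear 'rV[k]_n -> kmod U}),
    cancel l m /\ cancel m l.
Proof.
pose spans n := exists m : {linear 'rV[k]_n -> kmod U}, forall u, exists x, m
  x = u.
have [n0 hn0] : exists n, `[< spans n >].
  have [n hn] := free_cover (fin_gen_kmod (fgmodP U)).
  by exists n; apply/asboolP.
have := @ex_minnP (fun n => `[< spans n >]) (ex_intro _ n0 hn0).
case=> n /asboolP [m hm] hmin.
have minj x : m x = 0 -> x = 0.
  move=> hx; apply/rowP => j; apply/eqP; rewrite mxE; apply/negP => /negP xj.
  case: n m hm hmin x hx j xj => [|n] m hm hmin x hx j xj; first by case: j xj.
  suff /asboolP/hmin : spans n by rewrite ltnn.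
  exists (m \o mulmxr (row' j 1%:M)) => u; have [y <-] := hm u.
  (* Subtracting a multiple of x makes entry j zero without changing m y. *)
  pose y' := y - (y 0 j / x 0 j) *: x.
  exists (col' j y'); rewrite /=.
  have -> : col' j y' *m row' j 1%:M = y'.
    apply/rowP => i; rewrite !mxE; case: (unliftP j i) => [i' ->|->].
      rewrite (bigD1 i') //= !mxE eqxx mulr1 big1 ?addr0 // => l /negPf hl.
      by rewrite !mxE (inj_eq (@lift_inj _ j)) hl mulr0.
    rewrite big1 => [|l _]; last by rewrite !mxE eq_sym (negPf (neq_lift _ _))
      mulr0.
    by rewrite ?mxE divfK // subrr.
  by rewrite /y' linearB linearZ /= hx scaler0 subr0.
have injm : injective m.
  by move=> x y h; apply/subr0_eq/minj; rewrite linearB /= h subrr.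
have [|l hl] := @factor_inj k _ _ _ m idfun injm; first exact: hm.
by exists n, l, m; split=> [u|x]; [exact: hl | apply: injm; exact: hl].
Qed.

(** In k-coordinates f is a matrix, and the rows of its kernel matrix are
    generators, already over k. *)
Lemma noetherian (U V : fgmod R) (f : {linear U -> V}) : fin_gen (kernel f).
Proof.
have [n [l [m [lm ml]]]] := k_coordinates U.
have [n' [l' [m' [lm' ml']]]] := k_coordinates V.
pose G := lin1_mx (l' \o klin f \o m).
have GE x : x *m G = l' (klin f (m x)) by rewrite mul_rV_lin1.
have ker i : f (m (row i (kermx G))) = 0.
  rewrite -[LHS](lm' (klin f _)) -GE -row_mul mulmx_ker row0.
  by rewrite linear0.
have [e he] := choice (fun i => kernel_ex (ker i)).
exists n, e => x; set u := kernel_incl f x.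
have : (l u <= kermx G)%MS.
  by apply/sub_kermxP; rewrite GE lm -[klin f u]/(f u) kernel_inclP linear0.
case/submxP => D hD; exists (fun i => kscalar (D 0 i));
  apply: (@kernel_incl_inj _ _ _ f).
rewrite -/u -[LHS]lm hD mulmx_sum_row [LHS]linear_sum [RHS]linear_sum.
by apply: eq_bigr => i _; rewrite [LHS]linearZ [RHS]linearZ he.
Qed.

Section Coinduced.
Variable n : nat.

(** The module Hom_k(A, k^n), on which r acts by (r f)(x) = f(r x), where the
    product r x is taken in A and thus is x r in the converse ring. *)
Definition coind : Type := 'Hom(A, 'rV[k]_n).
HB.instance Definition _ := GRing.Zmodule.on coind.
Definition coind_scale (r : R) (f : coind) : coind :=
  ((f : 'Hom(A, 'rV[k]_n)) \o amull (r : A))%VF.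

Lemma coind_scaleE r f x :
  (coind_scale r f : 'Hom(A, 'rV[k]_n)) x = (f : 'Hom(A, 'rV[k]_n))
    ((r : A) * x).
Proof. by rewrite comp_lfunE lfunE. Qed.
Fact coind_scaleA a b f : coind_scale a (coind_scale b f) = coind_scale (a * b)
  f.
Proof. by apply/lfunP => x; rewrite !coind_scaleE mulrA. Qed.
Fact coind_scale1 : left_id 1 coind_scale.
Proof. by move=> f; apply/lfunP => x; rewrite coind_scaleE mul1r. Qed.
Fact coind_scaleDr : right_distributive coind_scale +%R.
Proof.
by move=> a f g; apply/lfunP => x; rewrite coind_scaleE !lfunE /= !coind_scaleE.
Qed.
Fact coind_scaleDl f : {morph coind_scale^~ f : a b / a + b}.
Proof.
move=> a b; apply/lfunP => x.
by rewrite coind_scaleE lfunE /= !coind_scaleE -linearD -mulrDl.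
Qed.
HB.instance Definition _ := GRing.Zmodule_isLmodule.Build R coind
  coind_scaleA coind_scale1 coind_scaleDr coind_scaleDl.

Lemma coind_fin_gen : fin_gen coind.
Proof.
pose b := vbasis {: 'Hom(A, 'rV[k]_n)}.
exists (\dim {: 'Hom(A, 'rV[k]_n)}), (fun i => b`_i : coind) => f.
exists (fun i => kscalar (coord b i f)).
rewrite {1}(coord_vbasis (memvf (f : 'Hom(A, 'rV[k]_n))));
  apply: eq_bigr => i _.
apply/lfunP => x; rewrite coind_scaleE lfunE /=.
by rewrite -scalerAl mul1r linearZ.
Qed.

Definition fg_coind : fgmod R := FgMod coind_fin_gen.

Section Adjunct.
Variables (U : lmodType R) (psi : {linear kmod U -> 'rV[k]_n}).
Let orbit_fun (u : U) (x : A) : 'rV[k]_n := psi ((x : R) *: u).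
Fact orbit_linear u : linear (orbit_fun u).
Proof.
move=> a x y; rewrite /orbit_fun -linearP; congr (psi _).
rewrite -[RHS]/(kscalar a *: ((x : R) *: u) + (y : R) *: u).
rewrite scalerA -scalerDl.
exact: (congr1 (fun z : A => (z + y : R) *: u) (kscalarE _ _)).
Qed.
Definition adjunct_fun (u : U) : coind := linfun (pack_linear (orbit_linear u)).
Lemma adjunct_funE u x :
  (adjunct_fun u : 'Hom(A, 'rV[k]_n)) x = psi ((x : R) *: u).
Proof. by rewrite lfunE. Qed.
Fact adjunct_linear : linear adjunct_fun.
Proof.
move=> a u v; apply/lfunP => x.
rewrite adjunct_funE lfunE /= coind_scaleE !adjunct_funE.
by rewrite -linearD scalerDr scalerA.
Qed.
(** The adjunction between restriction to k and coinduction. *)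
Definition adjunct : {linear U -> coind} := pack_linear adjunct_linear.
Lemma adjunctE u x : (adjunct u : 'Hom(A, 'rV[k]_n)) x = psi ((x : R) *: u).
Proof. exact: adjunct_funE. Qed.
End Adjunct.

(** By adjunction it suffices to extend a k-linear map, and the matrix of i in
    k-coordinates has a right inverse because its rows are independent. *)
Lemma coind_injective (K P : fgmod R) (i : {linear K -> P})
    (phi : {linear K -> coind}) :
  injective i -> exists t : {linear P -> coind}, forall x, t (i x) = phi x.
Proof.
move=> inji; have [a [l [m [lm ml]]]] := k_coordinates K.
have [b [l' [m' [lm' ml']]]] := k_coordinates P.
pose B := lin1_mx (l' \o klin i \o m).
have BE x : x *m B = l' (klin i (m x)) by rewrite mul_rV_lin1.
have Bfree : row_free B.
  apply: inj_row_free => x; rewrite BE => h.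
  apply: (can_inj ml); rewrite linear0; apply: inji; rewrite linear0.
  by apply: (can_inj lm'); rewrite [LHS]h linear0.
have lin : linear (fun p : kmod P =>
    (phi (m (l' p *m pinvmx B)) : 'Hom(A, 'rV[k]_n)) 1).
  move=> c p q; rewrite linearP mulmxDl -scalemxAl linearP.
  rewrite -[phi _]/(phi (kscalar c *: (m (l' p *m pinvmx B) : K) + m
    (l' q *m pinvmx B))).
  rewrite linearP lfunE /= coind_scaleE mulr1; congr (_ + _).
  by rewrite /kscalar linearZ.
exists (adjunct (pack_linear lin)) => x; apply/lfunP => y.
rewrite adjunctE /= -linearZ -[l' _]/(l' (klin i ((y : R) *: x))).
rewrite -[(y : R) *: x]lm -BE mulmxKp // lm linearZ /=.
by rewrite coind_scaleE mulr1.
Qed.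

End Coinduced.

(** The adjunct of a k-linear isomorphism with k^n; it is injective since
    evaluating at 1 gives back the coordinates. *)
Lemma embeds_in_coind (U : fgmod R) :
  exists n (f : {linear U -> coind n}), injective f.
Proof.
have [n [l [m [lm ml]]]] := k_coordinates U.
exists n, (adjunct l) => u v h; apply: (can_inj lm).
have := congr1 (fun f : 'Hom(A, 'rV[k]_n) => f 1) h.
by rewrite /= !adjunctE !scale1r.
Qed.

End FiniteDimensionalAlgebra.

(** * Twisted sums of complexes and the exact structure *)

Section Pairing.
Variables (R : pzRingType) (U V W : lmodType R).
Fact lin_pair_linear (f : {linear W -> U}) (g : {linear W -> V}) :
  linear (fun w => (f w, g w)).
Proof. by move=> a u v; rewrite !linearP. Qed.
Definition lin_pair f g : {linear W -> (U * V)%type} :=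
  pack_linear (lin_pair_linear f g).
Definition lin_copair (f : {linear U -> W}) (g : {linear V -> W}) :
  {linear (U * V)%type -> W} := (f \o fst) \+ (g \o snd).
End Pairing.

(** Chain maps and homotopies are built one degree at a time.  V is the
    invariant that lets the construction continue, T the relation wanted
    between consecutive components. *)
Lemma dependent_sequence (S : nat -> Type) (V : forall i, S i -> Prop)
    (T : forall i, S i -> S i.+1 -> Prop) (a0 : S 0%N) :
  V 0%N a0 -> (forall i a, V i a -> exists b, V i.+1 b /\ T i a b) ->
  exists s : forall i, S i,
    s 0%N = a0 /\ forall i, V i (s i) /\ T i (s i) (s i.+1).
Proof.
move=> V0 step.
pose nxt i (a : {a : S i | V i a}) := cid (step i (sval a) (svalP a)).
pose f := fix f i : {a : S i | V i a} := match i with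
  | 0 => exist _ a0 V0
  | j.+1 => exist _ (projT1 (nxt j (f j))) (proj1 (projT2 (nxt j (f j))))
  end.
exists (fun i => sval (f i)); split=> // i.
by split; [exact: svalP | exact: (proj2 (projT2 (nxt i (f i))))].
Qed.

Section Complexes.
Variables (R : pzRingType) (d : nat).
Local Notation cpx := (projcomplex R d).
Local Notation E := (projcomplex_exact R d).
Implicit Types X Y Z W : cpx.
Local Obligation Tactic := idtac.

(** The complex X[-1] with its degree-zero term dropped, in which the original
    degree 1 becomes degree 0.  It is the kernel of [cover X]. *)
Program Definition syzygy X : cpx :=
  @ProjComplex R d (fun i => term X i.+1) (fun i => \- diff X i.+1) _ _ _.
Next Obligation. by move=> X i x; rewrite /= linearN opprK diff_diff. Qed.
Next Obligation. by move=> X i; exact: term_projective. Qed.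
Next Obligation. by move=> X i hi x; apply: term_bounded; exact: ltnW. Qed.

Program Definition syzygy_map X Y (f : chainmap X Y) : chainmap (syzygy X)
  (syzygy Y) :=
  @ChainMap R d (syzygy X) (syzygy Y) (fun i => chain f i.+1) _.
Next Obligation. by move=> X Y f i x; rewrite /= linearN chain_diff. Qed.

Section Twist.
Variables (Y X : cpx) (th : chainmap (syzygy X) Y).

Lemma twist_cocycle i x : chain th i (diff X i.+1 x) = - diff Y i
  (chain th i.+1 x).
Proof. by rewrite -(chain_diff th) /= linearN opprK. Qed.

(** The extension of X by Y with cocycle th: its terms are the direct sums of
    those of Y and X, and its differential sends (y, x) to (dy + th x, dx).
    A chain map from the syzygy of X is exactly the datum for which this squares
    to zero. *)
Program Definition twist : cpx :=
  @ProjComplex R d (fun i => fg_prod (term Y i) (term X i))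
   (fun i => lin_pair (lin_copair (diff Y i) (chain th i)) (diff X i \o snd))
   _ _ _.
Next Obligation.
move=> i [y x]; rewrite /= linearD diff_diff add0r twist_cocycle subrr.
by rewrite diff_diff.
Qed.
Next Obligation. by move=> i; apply: projective_prod;
  exact: term_projective. Qed.
Next Obligation.
by move=> i hi [y x]; rewrite (term_bounded hi y) (term_bounded hi x).
Qed.

Program Definition twist_infl : chainmap Y twist :=
  @ChainMap R d Y twist (fun i => pair_l _ _) _.
Next Obligation. by move=> i x; rewrite /= !linear0 addr0. Qed.
Program Definition twist_defl : chainmap twist X :=
  @ChainMap R d twist X (fun i => snd) _.
Next Obligation. by []. Qed.

Lemma twist_conflation : degreewise_split twist_infl twist_defl.
Proof.
move=> i; split; last by exists (pair_r _ _).
split.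
- by move=> y y' [].
- by move=> x; exists (0, x).
- by move=> [y x] /=; split=> [->|[y' [_ <-]] //]; exists y.
Qed.

Definition twist_ses : ses (E := E) Y X :=
  Ses (twist_conflation : conflation (e := E) _ _).
End Twist.

Lemma chain_congr X Y (f g : chainmap X Y) : f = g ->
  forall i x, chain f i x = chain g i x.
Proof. by move->. Qed.

(** Every conflation is a twist: choose degreewise sections sg; their failure to
    commute with the differentials takes values in the kernel and defines the
    cocycle th. *)
Lemma ses_cocycle (Y X : E) (e : ses Y X) :
  exists (sg : forall i, {linear term X i -> term (mid e) i})
    (th : chainmap (syzygy X) Y),
    (forall i x, chain (defl e) i (sg i x) = x) /\
    (forall i x, diff (mid e) i (sg i.+1 x) =
       sg i (diff X i x) + chain (infl e) i (chain th i x)).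
Proof.
case: e => Z f g /= split_fg.
pose sg i : {linear term X i -> term Z i} := projT1 (cid (proj2 (split_fg i))).
have sgP i x : chain g i (sg i x) = x := projT2 (cid (proj2 (split_fg i))) x.
have fg i y : chain g i (chain f i y) = 0.
  by have [[_ _ ex] _] := split_fg i; apply/ex; exists y.
have fi i : injective (chain f i) by have [[]] := split_fg i.
have /(_ _)/cid-/all_tag [th0 thP] i : exists
  t : {linear term X i.+1 -> term Y i},
    forall x, chain f i (t x) = diff Z i (sg i.+1 x) - sg i (diff X i x).
  have [[injf _ ex] _] := split_fg i.
  apply: (factor_inj (h := (diff Z i \o sg i.+1) \- (sg i \o diff X i))) => //
    x.
  by apply/ex; rewrite linearB /= chain_diff !sgP subrr.
have th_chain i x : th0 i (diff (syzygy X) i x) = diff Y i (th0 i.+1 x).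
  apply: fi; rewrite /= !linearN thP !diff_diff linear0 subr0.
  by rewrite chain_diff thP linearB /= diff_diff add0r.
exists sg, (ChainMap th_chain); split=> // i x /=.
by rewrite thP addrC subrK.
Qed.

Lemma ses_retraction (Y X : E) (e : ses Y X)
    (sg : forall i, {linear term X i -> term (mid e) i}) :
  (forall i x, chain (defl e) i (sg i x) = x) ->
  exists rho : forall i, {linear term (mid e) i -> term Y i},
    forall i z, z = chain (infl e) i (rho i z) + sg i (chain (defl e) i z).
Proof.
case: e sg => Z f g /= split_fg sg sgP.
have /(_ _)/cid-/all_tag [rho rhoP] i : exists
  t : {linear term Z i -> term Y i},
    forall z, chain f i (t z) = z - sg i (chain g i z).
  have [[injf _ ex] _] := split_fg i.
  apply: (factor_inj (h := idfun \- (sg i \o chain g i))) => // z.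
  by apply/ex; rewrite linearB /= sgP subrr.
by exists rho => i z; rewrite rhoP subrK.
Qed.

Section TwistMap.
Variables (Y X Z : cpx) (th : chainmap (syzygy X) Y) (f : chainmap Y Z)
  (s : forall i, {linear term X i -> term Z i}).
Hypothesis sP : forall i x,
  diff Z i (s i.+1 x) = s i (diff X i x) + chain f i (chain th i x).
Program Definition twist_map : chainmap (twist th) Z :=
  @ChainMap R d (twist th) Z (fun i => lin_copair (chain f i) (s i)) _.
Next Obligation.
move=> i [y x] /=; rewrite !linearD /= sP !chain_diff -addrA; congr (_ + _).
exact: addrC.
Qed.
End TwistMap.

Section MapTwist.
Variables (Y X Z : cpx) (th : chainmap (syzygy X) Y) (g : chainmap Z X)
  (r : forall i, {linear term Z i -> term Y i}).
Hypothesis rP : forall i z,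
  r i (diff Z i z) = diff Y i (r i.+1 z) + chain th i (chain g i.+1 z).
Program Definition map_twist : chainmap Z (twist th) :=
  @ChainMap R d Z (twist th) (fun i => lin_pair (r i) (chain g i)) _.
Next Obligation. by move=> i z /=; rewrite rP chain_diff. Qed.
End MapTwist.

Lemma ses_exact_at (Y X : E) (e : ses Y X) i :
  short_exact (chain (infl e) i) (chain (defl e) i).
Proof. by case: (sesP e i). Qed.

Lemma ses_defl_infl (Y X : E) (e : ses Y X) i y :
  chain (defl e) i (chain (infl e) i y) = 0.
Proof. by have [_ _ ex] := ses_exact_at e i; apply/ex; exists y. Qed.

(** Pullback amounts to precomposing the cocycle with x. *)
Lemma cpx_pullback (Y X X' : E) (e : ses Y X) (x : hom X' X) :
  exists e' : ses Y X', ses_mor (idm Y) x e' e.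
Proof.
have [sg [th [sgP thP]]] := ses_cocycle e.
exists (twist_ses (chain_comp th (syzygy_map x))).
have hP i z : diff (mid e) i ((sg i.+1 \o chain x i.+1) z) =
    (sg i \o chain x i) (diff X' i z) +
    chain (infl e) i (chain (chain_comp th (syzygy_map x)) i z).
  by rewrite /= thP chain_diff.
exists (twist_map hP); split; apply: chainmap_ext => i z /=.
  by rewrite !linear0 addr0.
by rewrite linearD sgP ses_defl_infl add0r.
Qed.

(** Pushout amounts to composing the cocycle with y. *)
Lemma cpx_pushout (Y Y' X : E) (e : ses Y X) (y : hom Y Y') :
  exists e' : ses Y' X, ses_mor y (idm X) e e'.
Proof.
have [sg [th [sgP thP]]] := ses_cocycle e.
have [rho rhoP] := ses_retraction sgP.
have injf i : injective (chain (infl e) i) by have [] := ses_exact_at e i.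
exists (twist_ses (chain_comp y th)).
have hP i z : (chain y i \o rho i) (diff (mid e) i z) =
    diff Y' i ((chain y i.+1 \o rho i.+1) z) +
    chain (chain_comp y th) i (chain (defl e) i.+1 z).
  rewrite /= -chain_diff -linearD; congr (chain y i _); apply: injf.
  apply: (addIr (sg i (chain (defl e) i (diff (mid e) i z)))).
  have dz : diff (mid e) i z = chain (infl e) i (diff Y i (rho i.+1 z)) +
      (sg i (diff X i (chain (defl e) i.+1 z)) +
       chain (infl e) i (chain th i (chain (defl e) i.+1 z))).
    by rewrite -thP chain_diff -linearD -rhoP.
  by rewrite -rhoP [LHS]dz linearD (chain_diff (defl e)) addrA addrAC.
exists (map_twist hP); split; apply: chainmap_ext => i z //=.
rewrite ses_defl_infl; congr (chain y i _, _); apply: injf.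
have := rhoP i (chain (infl e) i z).
by rewrite ses_defl_infl linear0 addr0 => <-.
Qed.

(** The twist by the identity cocycle is contractible up to the term of X in
    degree zero; it plays the role of the projective cover. *)
Definition cover X : ses (E := E) (syzygy X) X :=
  twist_ses (chain_id (syzygy X)).

Section CoverMap.
Variables (X Z : cpx) (a : forall i, {linear term X i -> term Z i}).
(** The chain map with null-homotopy a.  The homotopy starts with a map out of
    the degree-zero term of X, which is invisible in the syzygy. *)
Program Definition null_map : chainmap (syzygy X) Z :=
  @ChainMap R d (syzygy X) Z
    (fun i => (diff Z i \o a i.+1) \- (a i \o diff X i)) _.
Next Obligation.
move=> i x /=; rewrite !linearN !linearB /= !diff_diff ?linear0 ?oppr0 ?sub0r.
by rewrite addr0.
Qed.
Lemma null_mapP i x : diff Z i (a i.+1 x) =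
  a i (diff X i x) + chain null_map i (chain (chain_id (syzygy X)) i x).
Proof. by rewrite /= addrC subrK. Qed.
Definition cover_map : chainmap (mid (cover X)) Z := twist_map null_mapP.
End CoverMap.

(** A map out of [cover X] is determined by its restriction to the second
    summands, since (y, dy) is the differential of (0, y). *)
Lemma cover_chainE X Z (t : chainmap (mid (cover X)) Z) i y :
  chain t i (pair_l _ _ y) = diff Z i (chain t i.+1 (pair_r _ _ y)) -
    chain t i (pair_r _ _ (diff X i y)).
Proof.
rewrite -(chain_diff t) -linearB; congr (chain t i _).
by rewrite -[RHS]/(diff (syzygy X) i 0 + y - 0, diff X i y - diff X i y) linear0
  add0r subr0 subrr.
Qed.

(** Chain maps out of [cover X] correspond to arbitrary families of maps out of
    the terms of X, so factoring through the inflation into [cover X] means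
    being null-homotopic. *)
Lemma cover_factorP X Y (phi : chainmap (syzygy X) Y) :
  (exists t : chainmap (mid (cover X)) Y, chain_comp t (infl (cover X)) =
    phi) <->
  (exists a : forall i, {linear term X i -> term Y i}, forall i x,
     chain phi i x = diff Y i (a i.+1 x) - a i (diff X i x)).
Proof.
split=> [[t <-]|[a ha]].
  by exists (fun i => chain t i \o pair_r _ _) => i x; exact: cover_chainE.
exists (cover_map a); apply: chainmap_ext => i x /=.
by rewrite !linear0 addr0 ha.
Qed.

(** Families of maps out of the terms of X lift along degreewise split
    epimorphisms. *)
Lemma cover_projective X : rel_projective (E := E) (mid (cover X)).
Proof.
move=> Y Z e f.
have [sg [th [sgP thP]]] := ses_cocycle e.
pose a i := sg i \o (chain f i \o pair_r (term (syzygy X) i) (term X i)).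
have aP i x : chain (defl e) i (a i x) = chain f i (pair_r _ _ x) := sgP _ _.
exists (cover_map a).
apply: chainmap_ext => i z; rewrite [in RHS](pair_lr z) linearD.
rewrite -[LHS]/(chain (defl e) i (diff (mid e) i (a i.+1 z.1) - a i
  (diff X i z.1)
  + a i z.2)).
by rewrite linearD linearB /= chain_diff !aP -cover_chainE.
Qed.

Lemma cpx_exact_with_projectives : exact_with_projectives E.
Proof.
split.
- by move=> Y X e; apply: chainmap_ext => i x; exact: ses_defl_infl.
- move=> Y X e W u hu; apply: chainmap_ext => i x.
  have [injf _ _] := ses_exact_at e i.
  by apply: injf; rewrite linear0; exact: (chain_congr hu).
- move=> Y X e W u hu.
  have /(_ _)/cid-/all_tag [t tP] i : exists t : {linear term W i -> term Y i},
      forall w, chain (infl e) i (t w) = chain u i w.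
    have [injf _ ex] := ses_exact_at e i.
    by apply: factor_inj => // w; apply/ex; exact: (chain_congr hu).
  have t_chain i w : t i (diff W i w) = diff Y i (t i.+1 w).
    have [injf _ _] := ses_exact_at e i.
    by apply: injf; rewrite tP !chain_diff tP.
  by exists (ChainMap t_chain); apply: chainmap_ext => i w; exact: tP.
- move=> Y X e W u hu.
  have /(_ _)/cid-/all_tag [t tP] i : exists t : {linear term X i -> term W i},
      forall z, t (chain (defl e) i z) = chain u i z.
    have [_ sur ex] := ses_exact_at e i.
    by apply: factor_surj => // z /ex [y <-]; exact: (chain_congr hu).
  have t_chain i x : t i (diff X i x) = diff W i (t i.+1 x).
    have [_ sur _] := ses_exact_at e i.+1; have [z <-] := sur x.
    by rewrite -chain_diff !tP chain_diff.
  by exists (ChainMap t_chain); apply: chainmap_ext => i w; exact: tP.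
- move=> Y X e W u hu; apply: chainmap_ext => i x.
  have [_ sur _] := ses_exact_at e i; have [z <-] := sur x.
  exact: (chain_congr hu).
- move=> Y X X' e x; exact: cpx_pullback.
- move=> Y Y' X e y; exact: cpx_pushout.
- by move=> X; exists (syzygy X), (cover X); exact: cover_projective.
Qed.

Definition exact_below (Y : cpx) : Prop :=
  forall i, (1 <= i <= d - 1)%N -> H_eq0 Y i.

Definition aug (X : cpx) : {linear term X 0 -> H0 X} := coker_pi (diff X 0).

Lemma aug_diff X x : aug X (diff X 0 x) = 0.
Proof.
rewrite -(linear0 (aug X)); apply/(coker_piP (diff X 0)).
by exists x; rewrite subr0.
Qed.

Lemma aug_surj X (z : H0 X) : exists x, aug X x = z.
Proof. exact: coker_pi_surj. Qed.

Lemma aug_eq0 X x : aug X x = 0 -> exists y, diff X 0 y = x.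
Proof.
move=> h; have [|y] := (coker_piP (diff X 0) x 0).1.
  by rewrite -/(aug X x) h -[RHS]/(aug X 0) linear0.
by rewrite subr0; exists y.
Qed.

(** Cycles of Y augmented by its zeroth homology. *)
Definition aug_cycle (Y : cpx) (i : nat) : term Y i -> Prop :=
  if i is j.+1 return term Y i -> Prop
  then fun y => diff Y j y = 0 else fun y => aug Y y = 0.

(** The inner homology vanishes only in degrees below d; in degree 0 the
    augmentation takes over. *)
Lemma exact_lift (Y : cpx) i (P : lmodType R) (f : {linear P -> term Y i}) :
  exact_below Y -> (i < d)%N -> projective P ->
  (forall x, aug_cycle (f x)) ->
  exists g : {linear P -> term Y i.+1}, forall x, diff Y i (g x) = f x.
Proof.
move=> exY hi hP hf; apply: projective_lift hP _ => x.
move: (hf x); case: i hi f {hf} => [|i] hi f; first exact: aug_eq0.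
by apply: (exY i.+1); rewrite /= -ltnS subn1 prednK //; exact: leq_trans hi.
Qed.

(** The comparison theorem.  Exactness of Y below degree d suffices because the
    terms of W vanish above degree d. *)
Lemma lift_chain_map W Y (f : {linear term W 0 -> H0 Y}) :
  exact_below Y -> (forall x, f (diff W 0 x) = 0) ->
  exists phi : chainmap W Y, forall x, aug Y (chain phi 0 x) = f x.
Proof.
move=> exY hf.
have [a0 ha0] := @term_projective _ _ W 0%N _ _ (aug Y) f (@aug_surj Y).
have {}ha0 x : aug Y (a0 x) = f x := ha0 x.
have [||s [s0 sP]] := @dependent_sequence
  (fun i => {linear term W i -> term Y i})
  (fun i a => forall x, aug_cycle (a (diff W i x)))
  (fun i a b => forall x, a (diff W i x) = diff Y i (b x)) a0.
- by move=> x /=; rewrite ha0.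
- move=> i a ha; have [hi|hi] := ltnP i d.
    have [b hb] := exact_lift (f := a \o diff W i) exY hi
      (@term_projective _ _ W _) ha.
    by exists b; split=> [x|x] /=; rewrite hb //= diff_diff linear0.
  exists 0; have W0 x : x = 0 :> term W i.+1 by exact: term_bounded.
  by split=> [x|x] /=; rewrite ?linear0 // (W0 x) !linear0.
by exists (ChainMap (fun i => (sP i).2)) => x /=; rewrite s0 ha0.
Qed.

(** The homotopy part of the comparison theorem.  It is only required that the
    composite with the augmentation extends along the differential of X; the
    extension g, lifted to Y, is the component of the homotopy in degree 0. *)
Lemma null_homotopic_of_aug X Y (phi : chainmap (syzygy X) Y)
  (g : {linear term X 0 -> H0 Y}) :
  exact_below Y ->
  (forall x, aug Y (chain phi 0 x) = g (diff X 0 x)) ->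
  exists a : forall i, {linear term X i -> term Y i}, forall i x,
     chain phi i x = diff Y i (a i.+1 x) - a i (diff X i x).
Proof.
move=> exY hg.
have [a0 ha0] := @term_projective _ _ X 0%N _ _ (aug Y) (\- g) (@aug_surj Y).
have {}ha0 x : aug Y (a0 x) = - g x := ha0 x.
have [||s [_ sP]] := @dependent_sequence
  (fun i => {linear term X i -> term Y i})
  (fun i a => forall x, aug_cycle (chain phi i x + a (diff X i x)))
  (fun i a b => forall x, chain phi i x = diff Y i (b x) - a (diff X i x)) a0.
- by move=> x /=; rewrite linearD /= ha0 hg subrr.
- move=> i a ha; have [hi|hi] := ltnP i d.
    have [b hb] := exact_lift (f := chain phi i \+ (a \o diff X i)) exY hi
      (@term_projective _ _ X i.+1) ha.
    exists b; split=> [x|x]; last by rewrite hb /= addrK.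
    rewrite /= linearD hb /= diff_diff linear0 addr0 -(chain_diff phi) /=.
    by rewrite linearN addNr.
  exists 0; have X0 x : x = 0 :> term X i.+1 by exact: term_bounded.
  split=> [x|x] /=; last by rewrite (X0 x) !linear0 ?addr0 ?subr0.
  by rewrite addr0 -(chain_diff phi) (X0 (diff (syzygy X) i x)) linear0.
by exists s => i; exact: (sP i).2.
Qed.

(** The vanishing of the cohomology of Hom(X, Z) in degree n + 1. *)
Definition cohom_eq0 (X : cpx) (Z : lmodType R) (n : nat) : Prop :=
  forall f : {linear term X n.+1 -> Z}, (forall x, f (diff X n.+1 x) = 0) ->
  exists g : {linear term X n -> Z}, forall x, f x = g (diff X n x).

Lemma cohom_syzygy X (V : lmodType R) n : cohom_eq0 (syzygy X) V n <->
  cohom_eq0 X V n.+1.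
Proof.
split=> h f hf.
  have [|g hg] := h f; first by move=> x /=; rewrite linearN hf oppr0.
  by exists (\- g) => x; rewrite hg /= linearN.
have [|g hg] := h f.
  by move=> x; apply: oppr_inj; rewrite oppr0 -linearN; exact: hf.
by exists (\- g) => x; rewrite hg /= linearN opprK.
Qed.

(** By dimension shift only n = 0 matters, where the condition on the left says
    that every chain map from the syzygy of X to Y is null-homotopic.  Such chain
    maps induce cocycles with values in the zeroth homology of Y, all cocycles
    arise in this way, and null-homotopic maps correspond to coboundaries. *)
Lemma ext_cpxP n X Y : exact_below Y ->
  Ext_eq0 (E := E) n.+1 X Y <-> cohom_eq0 X (H0 Y) n.
Proof.
move=> exY; elim: n X => [|n IH] X; last first.
  apply: iff_trans (ext_dimension_shift cpx_exact_with_projectives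
    (@cover_projective X) n Y) _.
  exact: iff_trans (IH _) (cohom_syzygy _ _ _).
apply: iff_trans (ext1_eq0P cpx_exact_with_projectives (@cover_projective X) Y)
  _.
split=> [h f hf|h phi]; last first.
  apply/cover_factorP; have [|g hg] := h (aug Y \o chain phi 0).
    move=> x; apply: oppr_inj; rewrite oppr0 -linearN
      /= -[RHS](aug_diff (chain phi 1 x)).
    by rewrite -(chain_diff phi).
  exact: null_homotopic_of_aug hg.
have [|phi hphi] := @lift_chain_map (syzygy X) Y f exY.
  by move=> x; rewrite /= linearN hf oppr0.
have [a ha] := (cover_factorP phi).1 (h phi).
exists (\- (aug Y \o a 0%N)) => x.
by rewrite -hphi ha linearB /= aug_diff sub0r.
Qed.

End Complexes.

(** * Cohomology of complexes and extensions of modules *)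

Section MoreComplexes.
Variables (R : pzRingType) (d : nat).
Local Notation cpx := (projcomplex R d).
Local Notation E := (projcomplex_exact R d).
Implicit Types X Y Z W N : cpx.
Local Obligation Tactic := idtac.

(** The map eta exhibits V as the zeroth homology of X; working with eta
    instead of V = H0 X avoids transporting Ext along isomorphisms. *)
Definition augmentation X (V : fgmod R) (eta : {linear term X 0 -> V}) : Prop :=
  (forall v, exists x, eta x = v) /\
  (forall x, eta x = 0 <-> exists y, diff X 0 y = x).

Lemma aug_augmentation X : augmentation (aug X).
Proof.
by split=> [|x]; [exact: aug_surj | split=> [/aug_eq0 //|[y <-]];
  exact: aug_diff].
Qed.

Lemma bijective_isomorphic (U V : fgmod R) (f : {linear U -> V}) :
  injective f -> (forall v, exists u, f u = v) ->
  isomorphic (C := fgmod_precat R) U V.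
Proof.
move=> injf surf; have [g gP] := factor_inj (h := idfun) injf surf.
exists f, g; split; apply: linear_ext => x /=; last exact: gP.
by apply: injf; rewrite gP.
Qed.

Lemma augmentation_iso X (V : fgmod R) (eta : {linear term X 0 -> V}) :
  augmentation eta -> isomorphic (C := fgmod_precat R) (H0 X) V.
Proof.
move=> [sur ker]; have [|f fP] := factor_surj (g := aug X) (h := eta)
  (@aug_surj _ _ X).
  by move=> x /aug_eq0 hx; apply/ker.
apply: (bijective_isomorphic (f := f)).
  apply: inj_of_ker => z; have [x <-] := aug_surj z.
  by rewrite fP => /ker [y <-]; exact: aug_diff.
by move=> v; have [x <-] := sur v; exists (aug X x); exact: fP.
Qed.

Lemma aug_syzygy_diff X x : aug (syzygy X) (diff X 1 x) = 0.
Proof. by apply: oppr_inj; rewrite oppr0 -linearN;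
  exact: (aug_diff (X := syzygy X)). Qed.

(** When X is exact in degree 1, the zeroth homology of its syzygy is the image
    of the differential, that is, the syzygy of V. *)
Lemma H0_syzygy_short_exact X (V : fgmod R) (eta : {linear term X 0 -> V}) :
  augmentation eta -> H_eq0 X 1 ->
  exists i : {linear H0 (syzygy X) -> term X 0},
    short_exact i eta /\ forall x, i (aug (syzygy X) x) = diff X 0 x.
Proof.
move=> [sur ker] exX.
have [|i iP] := factor_surj (g := aug (syzygy X)) (h := diff X 0)
  (@aug_surj _ _ (syzygy X)).
  by move=> x /aug_eq0 [y <-] /=; rewrite linearN diff_diff oppr0.
exists i; split=> //; split=> //.
  apply: inj_of_ker => z; have [x <-] := aug_surj z.
  by rewrite iP => /exX [y <-]; exact: aug_syzygy_diff.
move=> x; rewrite ker; split=> [[y <-]|[z <-]].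
  by exists (aug (syzygy X) y); exact: iP.
by have [y <-] := aug_surj z; exists y; rewrite iP.
Qed.

Lemma projective_rel_projective (P : fgmod R) :
  projective P -> rel_projective (E := fgmod_exact R) P.
Proof.
move=> hP Y W [U f h [/= injf surh ex]] a.
by have [b hb] := hP _ _ h a surh; exists b; apply: linear_ext.
Qed.

(** Dimension shift along the conflation with kernel the zeroth homology of the
    syzygy, where the induction hypothesis applies to [syzygy X]. *)
Lemma ext_modP n X (V : fgmod R) (eta : {linear term X 0 -> V}) (Z : fgmod R) :
  exact_with_projectives (fgmod_exact R) ->
  augmentation eta -> (forall i, (1 <= i <= n.+1)%N -> H_eq0 X i) ->
  Ext_eq0 (E := fgmod_exact R) n.+1 V Z <-> cohom_eq0 X Z n.
Proof.
move=> cat_exact; elim: n X V eta => [|n IH] X V eta eta_aug exX;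
have [i [se iP]] := H0_syzygy_short_exact eta_aug (exX 1%N isT);
pose s : ses (E := fgmod_exact R) (H0 (syzygy X)) V :=
  Ses (se : conflation (e := fgmod_exact R) _ _);
have ps : rel_projective (mid s) by
  (apply: projective_rel_projective; exact: term_projective).
- apply: iff_trans (ext1_eq0P cat_exact ps Z) _; split=> [h f hf|h phi].
    have [|phi phiP] := factor_surj (g := aug (syzygy X)) (h := f)
      (@aug_surj _ _ (syzygy X)).
      by move=> x /aug_eq0 [y <-] /=; rewrite linearN hf oppr0.
    have [t ht] := h phi; exists t => x.
    by rewrite -phiP -ht /= iP.
  have [|g hg] := h (phi \o aug (syzygy X)).
    by move=> x; rewrite /= aug_syzygy_diff linear0.
  exists g; apply: linear_ext => z; have [x <-] := aug_surj z.
  by rewrite /= iP -hg.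
- apply: iff_trans (ext_dimension_shift cat_exact ps n Z) _.
  apply: iff_trans (IH (syzygy X) _ _ (aug_augmentation (syzygy X)) _)
    (cohom_syzygy _ _ _).
  move=> [|j] // hj x /= hx.
  have [y hy] := exX j.+2 hj x (oppr_inj (etrans hx (esym (oppr0 _)))).
  by exists (- y); rewrite /= linearN opprK.
Qed.

(** The complex X[1], truncated so that it stays within degrees up to d. *)
Definition suspension_term X i : fgmod R :=
  if i is j.+1 then fg_if (j < d)%N (term X j) else fg_zero R.
Definition suspension_diff X i : {linear suspension_term X i.+1 ->
  suspension_term X i} :=
  match i return {linear suspension_term X i.+1 -> suspension_term X i} with
  | 0 => 0
  | j.+1 => \- (to_if (j < d)%N (term X j) \o diff X j \o
               of_if (j.+1 < d)%N (term X j.+1))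
  end.

Program Definition suspension X : cpx :=
  @ProjComplex R d (suspension_term X) (suspension_diff X) _ _ _.
Next Obligation.
move=> X [|i] x //=; rewrite !linearN opprK.
have /orP [h|h] := orbN (i.+2 < d)%N.
  by rewrite to_ifK ?diff_diff ?linear0 // ltnW.
by rewrite (fg_if_false x h) !linear0.
Qed.
Next Obligation.
move=> X [|i]; first exact: free_projective.
exact/fg_if_projective/term_projective.
Qed.
Next Obligation.
move=> X [|i] // hi x; apply: fg_if_false; rewrite -leqNgt; exact: hi.
Qed.

Program Definition suspension_cocycle X : chainmap (syzygy (suspension X)) X :=
  @ChainMap R d (syzygy (suspension X)) X (fun i => of_if (i < d)%N (term X i))
    _.
Next Obligation.
move=> X i x; rewrite /= opprK; have /orP [h|h] := orbN (i.+1 < d)%N.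
  by rewrite to_ifK // ltnW.
by rewrite (fg_if_false x h) !linear0.
Qed.

(** The dual of [cover]: an embedding of X into an object that is contractible
    up to the top term of X. *)
Definition cocover X : ses (E := E) X (suspension X) :=
  twist_ses (suspension_cocycle X).

(** The differential of (0, x) is (x, -dx), and every cycle (x, s) has this
    form. *)
Lemma cocover_exact X i (z : term (mid (cocover X)) i) : (i < d)%N ->
  (if i is j.+1 return term (mid (cocover X)) i -> Prop
   then fun z => diff (mid (cocover X)) j z = 0 else fun=> True) z ->
  exists y, diff (mid (cocover X)) i y = z.
Proof.
case: i z => [|i] [x s] hi /= hz.
  exists (0, to_if (0 < d)%N (term X 0) x); rewrite /= linear0 add0r to_ifK //.
  congr (_, _); exact: fg_zero_eq.
have hx : diff X i x = - of_if (i < d)%N (term X i) s.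
  by apply/eqP; rewrite -addr_eq0; apply/eqP; exact: (congr1 fst hz).
exists (0, to_if (i.+1 < d)%N (term X i.+1) x).
by rewrite /= linear0 add0r !to_ifK // hx linearN opprK of_ifK.
Qed.

(** The obstruction to extending f is the composite of f with the cocycle of the
    cocover, a chain map out of the syzygy of the suspension; it is
    null-homotopic because it vanishes after augmentation. *)
Lemma cocover_extend X Y (f : chainmap X Y) :
  exact_below Y -> (forall x, aug Y (chain f 0 x) = 0) ->
  exists t : chainmap (mid (cocover X)) Y, chain_comp t (infl (cocover X)) = f.
Proof.
move=> exY hf.
have [|a ha] := @null_homotopic_of_aug R d (suspension X) Y
  (chain_comp f (suspension_cocycle X)) 0 exY.
  by move=> x; rewrite hf.
have aP i x : diff Y i (a i.+1 x) =
    a i (diff (suspension X) i x) + chain f i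
      (chain (suspension_cocycle X) i x).
  by rewrite -[chain f i _]/(chain (chain_comp f (suspension_cocycle X)) i x) ha
    addrC subrK.
exists (twist_map aP); apply: chainmap_ext => i x /=.
by rewrite linear0 addr0.
Qed.

Section Sum.
Variables X Y : cpx.
Definition cpx_sum : cpx := twist (0 : chainmap (syzygy Y) X).
Definition sum_inl : chainmap X cpx_sum := twist_infl 0.
Definition sum_snd : chainmap cpx_sum Y := twist_defl 0.
Program Definition sum_inr : chainmap Y cpx_sum :=
  @ChainMap R d Y cpx_sum (fun i => pair_r _ _) _.
Next Obligation. by move=> i y /=; rewrite linear0 add0r. Qed.
Program Definition sum_fst : chainmap cpx_sum X :=
  @ChainMap R d cpx_sum X (fun i => fst) _.
Next Obligation. by move=> i y /=; rewrite addr0. Qed.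
Lemma cpx_sumP : direct_sum (C := E) X Y cpx_sum.
Proof.
exists sum_inl, sum_inr, sum_fst, sum_snd; split;
  apply: chainmap_ext => i z //=.
by rewrite [RHS](pair_lr z).
Qed.
End Sum.

Section Approximation.
Variables (X N : cpx) (f : chainmap X N).
Definition approx_mid : cpx := cpx_sum N (mid (cocover X)).
(** The sum of f with an inflation is an inflation for any f; these are the maps
    that will serve as left approximations. *)
Definition approx_infl : chainmap X approx_mid :=
  chain_comp (sum_inl _ _) f + chain_comp (sum_inr _ _) (infl (cocover X)).
Definition approx_coker : cpx := twist (- chain_comp f (suspension_cocycle X)).
Program Definition approx_defl : chainmap approx_mid approx_coker :=
  @ChainMap R d approx_mid approx_coker
    (fun i => lin_pair (lin_copair idfun (\- (chain f i \o fst))) (snd \o snd))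
      _.
Next Obligation.
move=> i [n [x s]] /=; rewrite addr0 linearB /= !linearD /= chain_diff.
by rewrite addrA.
Qed.
Lemma approx_conflation : degreewise_split approx_infl approx_defl.
Proof.
move=> i; split; last first.
  exists (lin_pair fst (pair_r _ _ \o snd)) => -[n s] /=.
  by rewrite linear0 oppr0 addr0.
have E1 x : chain approx_infl i x = (chain f i x, (x, 0)).
  by rewrite -[LHS]/(chain f i x + 0, (0 + x, 0 + 0)) addr0 !add0r.
split.
- by move=> x y; rewrite !E1 => -[].
- by move=> [n s]; exists (n, (0, s)); rewrite /= linear0 oppr0 addr0.
- move=> [n [x s]]; split=> [h|[y <-]].
    exists x; rewrite E1.
    have h1 : n - chain f i x = 0 := congr1 fst h.
    have h2 : s = 0 := congr1 snd h.
    by rewrite h2 (subr0_eq h1).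
  by rewrite E1 /= subrr.
Qed.
Definition approx_ses : ses (E := E) X approx_coker :=
  Ses (approx_conflation : conflation (e := E) _ _).
End Approximation.

Section Truncated.
Hypothesis noeth : forall (U V : fgmod R) (f : {linear U -> V}), fin_gen
  (kernel f).
Hypothesis d_gt0 : (0 < d)%N.

(** The terms are free covers of iterated kernels, cut off above degree d. *)
Lemma truncated_resolution (V : fgmod R) :
  exists N (eta : {linear term N 0 -> V}), exact_below N /\ augmentation eta.
Proof.
have /(_ _)/cid-/all_tag [F hF] (U : fgmod R) : exists F : fgmod R, projective F
  /\
    exists g : {linear F -> U}, forall u, exists v, g v = u.
  have [n [g hg]] := free_cover (fgmodP U).
  exists (FgMod (fin_gen_free R n)); split;
    [exact: free_projective | by exists g].
have pF U : projective (F U) by case: (hF U).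
have /(_ _)/cid-/all_tag [g gs] := fun U => (hF U).2.
pose K i := iter i (fun U => FgMod (noeth (g U))) V.
pose P i := F (K i).
pose inc i : {linear K i.+1 -> P i} := kernel_incl (g (K i)).
have ginc i z : g (K i) (inc i z) = 0 by exact: kernel_inclP.
have incI i : injective (inc i) by exact: kernel_incl_inj.
have inc_ex i u : g (K i) u = 0 -> exists z, inc i z = u by exact: kernel_ex.
clearbody inc.
pose N_term i := fg_if (i <= d)%N (P i).
pose N_diff i : {linear N_term i.+1 -> N_term i} :=
  to_if (i <= d)%N (P i) \o inc i \o g (K i.+1) \o of_if (i < d)%N (P i.+1).
have N_diffE i x : N_diff i x =
    to_if _ _ (inc i (g (K i.+1) (of_if (i < d)%N (P i.+1) x))) by [].
clearbody N_diff.
have N_dd i x : N_diff i (N_diff i.+1 x) = 0.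
  rewrite !N_diffE; have /orP [h|h] := orbN (i.+1 < d)%N; last first.
    by rewrite (fg_if_false x h) !linear0.
  by rewrite (to_ifK _ (ltnW h)) ginc !linear0.
have N_proj i : projective (N_term i) by exact/fg_if_projective/pF.
have N_bd i : (d < i)%N -> forall x : N_term i, x = 0.
  by move=> h x; apply: fg_if_false; rewrite -ltnNge.
have lift i (u : P i) : (i < d)%N -> g (K i) u = 0 ->
    exists y, N_diff i y = to_if (i <= d)%N (P i) u.
  move=> hi /inc_ex [z hz]; have [y hy] := gs (K i.+1) z.
  exists (to_if (i < d)%N (P i.+1) y).
  by rewrite N_diffE (to_ifK _ hi) hy hz.
exists (ProjComplex N_dd N_proj N_bd).
exists (g V \o of_if (0 <= d)%N (P 0%N)); split.
  move=> [|i] // hi x hx.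
  have hid : (i.+1 < d)%N by move: hi; rewrite /= -ltnS subn1 prednK.
  rewrite -(of_ifK (x : N_term i.+1)); apply: lift => //.
  apply: incI; rewrite linear0.
  rewrite -[LHS](to_ifK _ (ltnW (ltnW hid))).
  by rewrite -N_diffE [N_diff i x]hx linear0.
split=> [v|x].
  have [u <-] := gs V v; exists (to_if (0 <= d)%N (P 0%N) u).
  exact: (congr1 (g V) (to_ifK _ (leq0n d))).
split=> [hx|[y <-]].
  by have [y hy] := lift 0%N _ d_gt0 hx; exists y; rewrite [LHS]hy of_ifK.
apply: etrans (congr1 (g (K 0%N) \o of_if _ (P 0%N)) (N_diffE 0%N y)) _.
exact: etrans (congr1 (g (K 0%N)) (to_ifK _ (leq0n d))) (ginc 0%N _).
Qed.

End Truncated.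

Definition fg_free1 : fgmod R := FgMod (fin_gen_free R 1).

(** The free module of rank one in degree j. *)
Program Definition stalk j (hj : (j <= d)%N) : cpx :=
  @ProjComplex R d (fun i => fg_if (i == j)%N fg_free1) (fun i => 0) _ _ _.
Next Obligation. by []. Qed.
Next Obligation. by move=> j hj i; apply/fg_if_projective/free_projective. Qed.
Next Obligation.
by move=> j hj i hi x; apply: fg_if_false;
  rewrite neq_ltn (leq_ltn_trans hj hi) orbT.
Qed.

(** The syzygy of a stalk complex has the differential -0, so it agrees with the
    next stalk complex only up to this lemma. *)
Lemma projcomplex_eq_diff (T : nat -> fgmod R)
    (d1 d2 : forall i, {linear T i.+1 -> T i}) dd1 dd2 p1 p2 b1 b2 :
  d1 = d2 -> @ProjComplex R d T d1 dd1 p1 b1 = @ProjComplex R d T d2 dd2 p2 b2.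
Proof.
move=> e; case: d2 / e dd2 => dd2.
by rewrite (Prop_irrelevance dd1 dd2) (Prop_irrelevance p1 p2)
  (Prop_irrelevance b1 b2).
Qed.

Lemma syzygy_stalk j (hj : (j < d)%N) : syzygy (stalk hj) = stalk (ltnW hj).
Proof.
apply: projcomplex_eq_diff; apply: functional_extensionality_dep => i.
by apply: linear_ext => x; rewrite /= oppr0.
Qed.

(** The generator can be sent to any cycle. *)
Lemma stalk_map j (hj : (j <= d)%N) Y (y : term Y j) : cycle y ->
  exists (phi : chainmap (stalk hj) Y) (x : term (stalk hj) j), chain phi j x =
    y.
Proof.
move=> cy.
have [y' [y'j cy']] : exists y' : forall i, term Y i,
    y' j = y /\ forall i, cycle (y' i).
  exists (fun i => if j =P i is ReflectT e then eq_rect j (fun i => term Y i) y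
    i e
                   else 0); split=> [|i].
    by case: eqP => // e; rewrite (eq_irrelevance e erefl).
  case: eqP => [e|_]; first by case: i / e.
  by case: i => [|i] //=; rewrite linear0.
have lin i : linear (fun x : fg_free1 => (x : 'rV[R]_1) 0 0 *: y' i).
  by move=> a u v; rewrite !mxE scalerDl scalerA.
pose f i : {linear fg_if (i == j)%N fg_free1 -> term Y i} :=
  pack_linear (lin i) \o of_if _ _.
have f_chain i x : f i (diff (stalk hj) i x) = diff Y i (f i.+1 x).
  by rewrite linear0 /f /= linearZ /= (cy' i.+1) scaler0.
exists (ChainMap f_chain), (to_if (j == j)%N fg_free1 (const_mx 1)) => /=.
by rewrite to_ifK // mxE scale1r.
Qed.

(** Dimension shift moves the stalk from degree n + 1 + j to degree j + 1.  A
    chain map from the stalk in degree j to Y is the choice of a cycle, and as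
    the differential of the stalk is zero, a homotopy makes it a boundary. *)
Lemma ext_stalk n j (hj : (n.+1 + j <= d)%N) Y :
  Ext_eq0 (E := E) n.+1 (stalk hj) Y ->
  forall y : term Y j, cycle y -> exists z, diff Y j z = y.
Proof.
elim: n hj => [|n IH] hj; last first.
  move/(ext_dimension_shift (cpx_exact_with_projectives R d)
    (@cover_projective _ _ (stalk hj))).
  by rewrite syzygy_stalk; exact: IH.
move=> h y cy; have hj' : (j <= d)%N by exact: ltnW.
have /(ext1_eq0P (cpx_exact_with_projectives R d)
  (@cover_projective _ _ (stalk hj))) {}h := h.
have [phi [x <-]] : exists (phi : chainmap (syzygy (stalk hj)) Y)
    (x : term (syzygy (stalk hj)) j), chain phi j x = y.
  rewrite syzygy_stalk (_ : ltnW hj = hj'); first exact: stalk_map.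
  exact: Prop_irrelevance.
have [a ha] := (cover_factorP phi).1 (h phi).
by exists (a j.+1 x); rewrite ha [X in _ - X]linear0 subr0.
Qed.

(** A part of the long exact cohomology sequence: the next group of X3 vanishes
    if that of the middle term does and cocycles extend from X1. *)
Lemma cohom_coker X1 X3 (a : ses (E := E) X1 X3) (V : lmodType R) n :
  cohom_eq0 (mid a) V n ->
  (forall g : {linear term X1 n -> V}, (forall x, g (diff X1 n x) = 0) ->
     exists h : {linear term (mid a) n -> V},
       (forall z, h (diff (mid a) n z) = 0) /\
       (forall x, h (chain (infl a) n x) = g x)) ->
  cohom_eq0 X3 V n.
Proof.
move=> hmid ext f hf.
have [|g hg] := hmid (f \o chain (defl a) n.+1).
  by move=> x; rewrite /= chain_diff hf.
have [|h [hd hi]] := ext (g \o chain (infl a) n).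
  by move=> x; rewrite /= chain_diff -hg /= ses_defl_infl linear0.
have [_ sur ex] := ses_exact_at a n.
have [|t tP] := factor_surj (h := g \- h) sur.
  by move=> z /ex [x <-]; rewrite /= hi subrr.
exists t => x; have [_ sur' _] := ses_exact_at a n.+1.
have [z <-] := sur' x.
by rewrite -chain_diff tP /= hd subr0 -hg.
Qed.

(** In positive degrees a cocycle on X1 is a coboundary, and the cochain it
    comes from extends because the conflation splits degreewise. *)
Lemma cocycle_extends X1 X3 (a : ses (E := E) X1 X3) (V : lmodType R) n
    (g : {linear term X1 n.+1 -> V}) :
  cohom_eq0 X1 V n -> (forall x, g (diff X1 n.+1 x) = 0) ->
  exists h : {linear term (mid a) n.+1 -> V},
    (forall z, h (diff (mid a) n.+1 z) = 0) /\
    (forall x, h (chain (infl a) n.+1 x) = g x).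
Proof.
move=> h0 hg; have [g1 hg1] := h0 g hg.
have [sg [_ [sgP _]]] := ses_cocycle a.
have [rho rhoP] := ses_retraction sgP.
(* If g = g1 d, the extension is h d for an extension h of g1. *)
exists (g1 \o rho n \o diff (mid a) n); split=> [z|x] /=.
  by rewrite diff_diff !linear0.
rewrite hg1 -chain_diff; congr (g1 _).
have [inj _ _] := ses_exact_at a n; apply: inj.
have := rhoP n (chain (infl a) n (diff X1 n x)).
by rewrite ses_defl_infl linear0 addr0 => <-.
Qed.

Lemma cohom_iso X (U V : fgmod R) n :
  isomorphic (C := fgmod_precat R) U V -> cohom_eq0 X U n -> cohom_eq0 X V n.
Proof.
move=> [f [g [gf fg]]] h u hu.
have fgK v : f (g v) = v := congr1 (fun a : {linear V -> V} => a v) fg.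
have [|w hw] := h ((g : {linear V -> U}) \o u); first by move=> x;
  rewrite /= hu linear0.
by exists ((f : {linear U -> V}) \o w) => x; rewrite /= -hw /= fgK.
Qed.

(** A contracting homotopy gives g(y, x) = f(0, y). *)
Lemma cover_cohom X (V : lmodType R) n : cohom_eq0 (mid (cover X)) V n.
Proof.
move=> f hf; exists (f \o pair_r _ _ \o fst) => -[y x] /=.
have h : f (y, diff X n.+1 y) = 0.
  rewrite -[RHS](hf (0, y)); congr (f _).
  by rewrite -[RHS]/(- diff X _ 0 + y, diff X n.+1 y) linear0 oppr0 add0r.
rewrite -[f (y, x)]subr0 -h -linearB; congr (f _).
by rewrite -[LHS]/(y - y, x - diff X n.+1 y) subrr addrC.
Qed.

(** The class of a cycle x in the cokernel of the incoming differential goes to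
    zero under h, as h composed with the projection extends along the outgoing
    differential. *)
Lemma coker_embed_exact X (V : fgmod R) n
  (h : {linear coker (diff X n.+1) -> V}) :
  injective h -> cohom_eq0 X V n -> H_eq0 X n.+1.
Proof.
move=> inj h0 x hx.
have [|g hg] := h0 (h \o coker_pi (diff X n.+1)).
  move=> y; rewrite /= (_ : coker_pi _ _ = 0) ?linear0
    // -(linear0 (coker_pi (diff X n.+1))).
  by apply/coker_piP; exists y; rewrite subr0.
have : coker_pi (diff X n.+1) x = coker_pi (diff X n.+1) 0.
  by apply: inj; rewrite !linear0 [LHS](hg x) [diff X n x]hx linear0.
by move/coker_piP => [y]; rewrite subr0; exists y.
Qed.

End MoreComplexes.

(** * Homology and the additive structure *)

Section Homology.
Variables (R : pzRingType) (d : nat).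
Local Notation cpx := (projcomplex R d).
Local Notation E := (projcomplex_exact R d).
Implicit Types X Y Z : cpx.

Lemma cycle_chain X Y (f : chainmap X Y) i x : cycle x -> cycle (chain f i x).
Proof. by case: i x => [|i] x //= hx; rewrite -chain_diff hx linear0. Qed.

Lemma H_eq0_retract X Y (f : chainmap X Y) (g : chainmap Y X) i :
  (forall y, chain f i (chain g i y) = y) -> H_eq0 X i -> H_eq0 Y i.
Proof.
move=> fg h y cy; have [x hx] := h _ (cycle_chain g cy).
by exists (chain f i.+1 x); rewrite -chain_diff hx fg.
Qed.

Lemma H0_map_ex X Y (f : chainmap X Y) :
  exists h : {linear H0 X -> H0 Y}, forall x, h (aug X x) = aug Y (chain f 0 x).
Proof.
apply: (factor_surj (h := aug Y \o chain f 0)); first exact: aug_surj.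
by move=> x /aug_eq0 [y <-]; rewrite /= chain_diff aug_diff.
Qed.

Definition H0_map X Y (f : chainmap X Y) : {linear H0 X -> H0 Y} :=
  projT1 (cid (H0_map_ex f)).
Lemma H0_mapE X Y (f : chainmap X Y) x :
  H0_map f (aug X x) = aug Y (chain f 0 x).
Proof. exact: (projT2 (cid (H0_map_ex f))). Qed.

Lemma H0_map_id X (f : chainmap X X) : f = chain_id X ->
  H0_map f = lin_id (H0 X).
Proof.
move=> ->; apply: linear_ext => z; have [x <-] := aug_surj z.
by rewrite H0_mapE.
Qed.
Lemma H0_map_comp X Y Z (g : chainmap Y Z) (f : chainmap X Y) :
  lin_comp (H0_map g) (H0_map f) = H0_map (chain_comp g f).
Proof.
by apply: linear_ext => z; have [x <-] := aug_surj z; rewrite /= !H0_mapE.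
Qed.
Lemma H0_map0 X Y : H0_map (0 : chainmap X Y) = 0.
Proof.
apply: linear_ext => z; have [x <-] := aug_surj z.
by rewrite H0_mapE /= linear0.
Qed.
Lemma H0_mapD X Y (f g : chainmap X Y) : H0_map (f + g) = H0_map f + H0_map g.
Proof.
apply: linear_ext => z; have [x <-] := aug_surj z.
by rewrite /= !H0_mapE /= linearD.
Qed.

Lemma H0_isomorphic X Y : isomorphic (C := E) X Y ->
  isomorphic (C := fgmod_precat R) (H0 X) (H0 Y).
Proof.
move=> [f [g [gf fg]]]; exists (H0_map f), (H0_map g).
by rewrite /= !H0_map_comp !H0_map_id.
Qed.

Lemma H0_direct_sum X Y S : direct_sum (C := E) X Y S ->
  direct_sum (C := fgmod_precat R) (H0 X) (H0 Y) (H0 S).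
Proof.
move=> [i1 [i2 [p1 [p2 [h1 h2 h3 h4 h5]]]]].
exists (H0_map i1), (H0_map i2), (H0_map p1), (H0_map p2).
rewrite /= !H0_map_comp -H0_mapD; split.
- exact: H0_map_id.
- exact: H0_map_id.
- by rewrite -(H0_map0 Y X); congr H0_map.
- by rewrite -(H0_map0 X Y); congr H0_map.
- exact: H0_map_id.
Qed.

Lemma Pd_additive (M : fgmod R -> Prop) :
  additive_subcat (C := fgmod_precat R) M -> additive_subcat (C := E) (Pd d M).
Proof.
move=> [Miso Mzero Msum Msummand]; split.
- move=> X Y XY [hM hX]; split; first exact: Miso (H0_isomorphic XY) hM.
  have [f [g [_ fg]]] := XY => i hi.
  apply: (H_eq0_retract (f := f) (g := g)) (hX i hi) => y.
  exact: (chain_congr fg).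
- move=> Z [hZ _]; have Z0 i (x : term Z i) : x = 0.
    exact: (chain_congr (hZ Z (idm Z))).
  have H0Z (z : H0 Z) : z = 0 by have [x <-] := aug_surj z;
    rewrite (Z0 _ x) linear0.
  split=> [|i _ x _]; last by exists 0; rewrite linear0 [RHS]Z0.
  apply: Mzero; split=> U f; apply: linear_ext => x; first exact: H0Z.
  by rewrite (H0Z x) !linear0.
- move=> X Y S XYS [MX hX] [MY hY]; split.
    exact: Msum (H0_direct_sum XYS) MX MY.
  have [i1 [i2 [p1 [p2 [_ _ _ _ h]]]]] := XYS => i hi s cs.
  have [x hx] := hX i hi _ (cycle_chain p1 cs).
  have [y hy] := hY i hi _ (cycle_chain p2 cs).
  exists (chain i1 _ x + chain i2 _ y).
  rewrite linearD -!chain_diff hx hy; exact: (chain_congr h).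
- move=> X Y S XYS [MS hS]; split; first exact: Msummand (H0_direct_sum XYS) MS.
  have [i1 [i2 [p1 [p2 [h _ _ _ _]]]]] := XYS => i hi.
  apply: (H_eq0_retract (f := p1) (g := i1)) (hS i hi) => x.
  exact: (chain_congr h).
Qed.

(** A complex without homology below degree d belongs to the subcategory
    because the zero module belongs to M. *)
Lemma Pd_of_acyclic (M : fgmod R -> Prop) X :
  additive_subcat (C := fgmod_precat R) M ->
  (forall z : H0 X, z = 0) -> exact_below X -> Pd d M X.
Proof.
move=> [_ Mzero _ _] H0X exX; split=> //.
apply: Mzero; split=> U f; apply: linear_ext => x; first exact: H0X.
by rewrite (H0X x) !linear0.
Qed.

Lemma cocover_Pd (M : fgmod R -> Prop) X :
  (0 < d)%N -> additive_subcat (C := fgmod_precat R) M ->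
    Pd d M (mid (cocover X)).
Proof.
move=> d0 hM; apply: Pd_of_acyclic => //.
  move=> z; have [x <-] := aug_surj z.
  by have [|y <-] := @cocover_exact _ _ X 0%N x d0 => //; exact: aug_diff.
move=> [|i] // hi x hx; apply: cocover_exact => //.
by move: hi; rewrite /= -ltnS subn1 prednK.
Qed.

End Homology.

(** * Orthogonality and approximations *)

Section Main.
Variables (d : nat) (hd : (1 <= d)%N) (k : fieldType) (A : falgType k).
Local Notation R := (A^c).
Variables (M : fgmod_exact R -> Prop) (hM : cluster_tilting_mod d M).
Local Notation E := (projcomplex_exact R d).
Local Notation cpx := (projcomplex R d).

Let Madd : additive_subcat M. Proof. by case: hM. Qed.
Let mod_exact : exact_with_projectives (fgmod_exact R).
Proof. apply: fgmod_exact_with_projectives => U V f. exact: (noetherian f). Qed.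
Let cat_exact : exact_with_projectives E := cpx_exact_with_projectives R d.
Let M_iso (U V : fgmod R) : isomorphic (C := fgmod_precat R) U V -> M U -> M V.
Proof. by case: Madd => h _ _ _ UV MU; exact: (h U V UV MU). Qed.

(** Coinduced modules are injective. *)
Lemma coind_ext n m (U : fgmod R) :
  Ext_eq0 (E := fgmod_exact R) n.+1 U (fg_coind A m).
Proof.
elim: n U => [|n IH] U; have [K [s ps]] := enough_projectives mod_exact U.
  apply/(ext1_eq0P mod_exact ps) => phi.
  have [inj _ _] : short_exact (infl s) (defl s) := sesP s.
  have [t ht] := coind_injective phi inj.
  by exists t; apply: linear_ext.
exact/(ext_dimension_shift mod_exact ps).
Qed.

Lemma resolution_in_Pd (V : fgmod R) : M V ->
  exists (N : cpx) (eta : {linear term N 0 -> V}), Pd d M N /\ augmentation eta.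
Proof.
move=> MV.
have [N [eta [exN he]]] := truncated_resolution
  (fun U V f => noetherian f) hd V.
exists N, eta; split=> //; split=> //; apply: M_iso MV.
by have [f [g [gf fg]]] := augmentation_iso he; exists g, f.
Qed.

(** Every module of M is the zeroth homology of a complex of the subcategory. *)
Lemma cohom_of_ext (X : cpx) n :
  (forall N, Pd d M N -> Ext_eq0 (E := E) n.+1 X N) ->
  forall V, M V -> cohom_eq0 X V n.
Proof.
move=> h V /resolution_in_Pd [N [eta [PN he]]].
by apply: cohom_iso (augmentation_iso he) _; apply/ext_cpxP;
  [case: PN | exact: h].
Qed.

(** Coinduced modules belong to M by the right orthogonality of M.  Testing with
    them shows that X has no inner homology; then X computes the extensions of
    its zeroth homology, which belongs to M by the left orthogonality. *)
Lemma Pd_of_cohom (X : cpx) :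
  (forall V, M V -> forall n, (n < d - 1)%N -> cohom_eq0 X V n) -> Pd d M X.
Proof.
move=> h; have exX : exact_below X.
  move=> [|n] // hn.
  have [m [f injf]] := embeds_in_coind
    (FgMod (coker_fin_gen (diff X n.+1) (fgmodP _))).
  apply: (coker_embed_exact (V := fg_coind A m) injf); apply: h => //.
  case: hM => _ _ [_ orth]; apply/orth => W MW [|i] // hi; exact: coind_ext.
split=> //; case: hM => _ _ [orth _]; apply/orth => V MV [|n] // hn.
apply/(ext_modP V mod_exact (aug_augmentation X)); last exact: h.
by move=> i /andP [i1 i2]; apply: exX; rewrite i1 (leq_trans i2).
Qed.

Lemma Pd_rigid (X Y : cpx) n : Pd d M X -> Pd d M Y -> (n < d - 1)%N ->
  Ext_eq0 (E := E) n.+1 X Y.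
Proof.
move=> [MX exX] [MY exY] hn; apply/ext_cpxP => //.
apply/(ext_modP _ mod_exact (aug_augmentation X)).
  by move=> i /andP [i1 i2]; apply: exX; rewrite i1 (leq_trans i2).
by case: hM => _ _ [orth _]; apply: (orth _).1.
Qed.

Lemma Pd_left_orthogonal (X : cpx) : Pd d M X <->
  forall N, Pd d M N -> forall i, (1 <= i <= d - 1)%N -> Ext_eq0 (E := E) i X N.
Proof.
split=> [PX N PN [|n] // hn|h]; first exact: Pd_rigid.
apply: Pd_of_cohom => V MV n hn; apply: cohom_of_ext MV => N PN; exact: h.
Qed.

Lemma stalk_Pd j (hj : (j <= d)%N) : j = d -> Pd d M (stalk R hj).
Proof.
move=> jd; apply: Pd_of_acyclic => // [z|[|i] // hi x _].
  have [x <-] := aug_surj z; rewrite (_ : x = 0) ?linear0 //.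
  by apply: fg_if_false; rewrite jd neq_ltn hd.
have id : (i.+1 < d)%N by move: hi; rewrite /= -ltnS subn1 prednK.
by exists 0; rewrite linear0; apply/esym/fg_if_false; rewrite jd neq_ltn id.
Qed.

(** Testing with the stalk complex in degree d shows that Y has no inner
    homology.  The zeroth homology of Y is then tested against a module V of M
    through a truncated resolution of V. *)
Lemma Pd_right_orthogonal (Y : cpx) : Pd d M Y <->
  forall N, Pd d M N -> forall i, (1 <= i <= d - 1)%N -> Ext_eq0 (E := E) i N Y.
Proof.
split=> [PY N PN [|n] // hn|h]; first exact: Pd_rigid.
have exY : exact_below Y.
  move=> j /andP [j1 j2]; have jd : (j < d)%N by move: j2;
    rewrite -ltnS subn1 prednK.
  have e : ((d - j).-1.+1 + j = d)%N by rewrite prednK ?subn_gt0 // subnK //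
    ltnW.
  (* An extension of degree d - j sees the homology in degree j. *)
  have hj : ((d - j).-1.+1 + j <= d)%N by rewrite e.
  apply: (ext_stalk (hj := hj)); apply: h; first exact: stalk_Pd.
  by rewrite prednK ?subn_gt0 // jd leq_sub2l.
split=> //; case: hM => _ _ [_ orth]; apply/orth => V MV [|n] // hn.
have [N [eta [PN he]]] := resolution_in_Pd MV.
apply/(ext_modP _ mod_exact he); last by apply/ext_cpxP => //; exact: h.
by move=> i /andP [i1 i2]; apply: PN.2; rewrite i1 (leq_trans i2).
Qed.

Lemma cover_Pd (X : cpx) : Pd d M (mid (cover X)).
Proof. by apply: Pd_of_cohom => V _ n _; exact: cover_cohom. Qed.

Lemma Pd_sum (X Y : cpx) : Pd d M X -> Pd d M Y -> Pd d M (cpx_sum X Y).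
Proof. by have [_ _ h _] := Pd_additive d Madd; exact/h/cpx_sumP. Qed.

(** Take a left approximation a of H0 X by some V in M and a lift f of a to the
    truncated resolution N of V.  A map g from X to an object of the subcategory
    factors through f up to a map that vanishes on H0, and such a map factors
    through the cocover. *)
Lemma left_approximation (X : cpx) : exists (C : cpx) (a : ses (E := E) X C),
  Pd d M (mid a) /\
  forall (N : cpx) (g : chainmap X N), Pd d M N ->
    exists h : chainmap (mid a) N, chain_comp h (infl a) = g.
Proof.
have [_ [_ /(_ (H0 X)) [V [a [MV ha]]]] _] := hM.
have [N [eta [PN he]]] := resolution_in_Pd MV.
have [i [j [ij ji]]] := augmentation_iso he.
have [|f hf] := lift_chain_map (f := (j : {linear V -> H0 N}) \o
  (a : {linear H0 X -> V}) \o aug X) PN.2.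
  by move=> x; rewrite /= aug_diff !linear0.
exists (approx_coker f), (approx_ses f); split.
  by apply: Pd_sum => //; exact: cocover_Pd.
move=> N' g PN'.
have [b hb] := ha (H0 N') (H0_map g) PN'.1.
have {}hb z : (b : {linear V -> H0 N'}) ((a : {linear H0 X -> V}) z) = H0_map g
  z.
  exact: (congr1 (fun u : {linear H0 X -> H0 N'} => u z) hb).
have jiK v : (i : {linear H0 N -> V}) ((j : {linear V -> H0 N}) v) = v.
  exact: (congr1 (fun u : {linear V -> V} => u v) ji).
have [|be hbe] := lift_chain_map (f := (b : {linear V -> H0 N'}) \o
  (i : {linear H0 N -> V}) \o aug N) PN'.2.
  by move=> x; rewrite /= aug_diff !linear0.
have [|t ht] := cocover_extend (f := g - chain_comp be f) PN'.2.
  by move=> x; rewrite /= linearB /= hbe /= hf /= jiK hb H0_mapE subrr.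
exists (chain_comp be (sum_fst _ _) + chain_comp t (sum_snd _ _)).
apply: chainmap_ext => l x.
have := chain_congr ht x => /= ht'.
by rewrite addr0 add0r ht' addrC subrK.
Qed.

(** The cokernel of a left approximation is orthogonal in one more degree: in
    the lowest degree because maps from X extend to the middle term, in higher
    degrees by the long exact sequence. *)
Lemma approximation_coker_cohom (X C : cpx) (a : ses (E := E) X C) m :
  (m.+1 <= d - 1)%N -> Pd d M (mid a) ->
  (forall (N : cpx) (g : chainmap X N), Pd d M N ->
    exists h : chainmap (mid a) N, chain_comp h (infl a) = g) ->
  (forall V, M V -> forall n, (n < m)%N -> cohom_eq0 X V n) ->
  forall V, M V -> forall n, (n < m.+1)%N -> cohom_eq0 C V n.
Proof.
move=> hm Pa ext hX V MV n hn; apply: (cohom_coker (a := a)).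
  apply: cohom_of_ext MV => N PN; apply: Pd_rigid => //.
  exact: leq_trans hn hm.
case: n hn => [|n] hn g hg; last by apply: cocycle_extends hg; exact: hX.
have [N [eta [PN he]]] := resolution_in_Pd MV.
have [i [j [ij ji]]] := augmentation_iso he.
have [|f hf] := lift_chain_map (f := (j : {linear V -> H0 N}) \o g) PN.2.
  by move=> x; rewrite /= hg linear0.
have [h hh] := ext N f PN.
have jiK v : (i : {linear H0 N -> V}) ((j : {linear V -> H0 N}) v) = v.
  exact: (congr1 (fun u : {linear V -> V} => u v) ji).
exists ((i : {linear H0 N -> V}) \o aug N \o chain h 0); split=> x /=.
  by rewrite chain_diff aug_diff linear0.
by rewrite [chain h _ _](chain_congr hh x) hf /= jiK.
Qed.

(** The object C is an m-fold cosyzygy of the m-th syzygy of X, formed with left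
    approximations.  The second conclusion says that every g factors through f
    modulo projectives.  In the induction, the map t induced by g on syzygies is
    factored first; its factor u extends from the syzygy of W to the cover of W
    because W has no extensions by objects of the subcategory, and so induces
    the factor u1 of g. *)
Lemma approximation_tower m (X : E) : (m <= d - 1)%N ->
  exists (C : E) (f : hom C X),
    (forall V, M V -> forall n, (n < m)%N -> cohom_eq0 C V n) /\
    (forall W : E,
       (forall N, Pd d M N -> forall n, (n < m)%N -> Ext_eq0 n.+1 W N) ->
       forall g : hom W X, exists (u : hom W C) (v : hom W (mid (cover X))),
         g = f \c u + defl (cover X) \c v).
Proof.
elim: m X => [|m IH] X hm.
  exists X, (idm X); split=> // W _ g; exists g, 0.
  by rewrite comp1m compm0 addr0.
have [C0 [f0 [cohC0 fac]]] := IH (syzygy X) (ltnW hm).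
have [C [a [Pa ext]]] := left_approximation C0.
have [F hF] : exists F : hom (mid a) (mid (cover X)),
    F \c infl a = infl (cover X) \c f0 := ext _ _ (cover_Pd X).
have [|f hf] := defl_coker cat_exact (e := a) (u := defl (cover X) \c F).
  by rewrite -compA hF compA (ses_comp0 cat_exact) comp0m.
exists C, f; split.
  exact: approximation_coker_cohom hm Pa ext cohC0.
move=> W hW g.
have extW (N : E) (phi : hom (syzygy W : E) N) : Pd d M N ->
    exists t : hom (mid (cover W)) N, t \c infl (cover W) = phi.
  move=> PN.
  exact: ((ext1_eq0P cat_exact (@cover_projective _ _ W) N).1
    (hW N PN 0%N isT)).
have [G hG] := @cover_projective _ _ W _ _ (cover X) (g \c defl (cover W)).
have [|t ht] := infl_ker cat_exact (e := cover X) (u := G \c infl (cover W)).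
  by rewrite compA hG -compA (ses_comp0 cat_exact) compm0.
have [|u [v tE]] := fac (syzygy W) _ t.
  move=> N PN n hn; apply/(ext_dimension_shift cat_exact
    (@cover_projective _ _ W)).
  exact: hW.
have [u' hu'] := extW _ (infl a \c u) Pa.
have [v' hv'] := extW _ v (cover_Pd (syzygy X)).
have [|u1 hu1] := defl_coker cat_exact (e := cover W) (u := defl a \c u').
  by rewrite -compA hu' compA (ses_comp0 cat_exact) comp0m.
(* D is a lift of g - f u1 through covers that vanishes on the syzygy of W. *)
pose D := G - F \c u' - infl (cover X) \c (defl (cover (syzygy X)) \c v').
have [|w hw] := defl_coker cat_exact (e := cover W) (u := D).
  rewrite !compBm -ht -!compA hu' hv' (compA F) hF -!compA -!compmB tE.
  by rewrite addrAC addrK subrr compm0.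
exists u1, w; apply/subr0_eq/(defl_epi cat_exact (e := cover W)).
rewrite compBm compDl -!compA hu1 hw (compA f) hf -compA -compDr.
rewrite -hG -compmB opprD addrA.
rewrite /D subKr; apply: etrans (compA _ _ _) _.
by rewrite (ses_comp0 cat_exact) comp0m.
Qed.

Lemma right_approximation (X : E) : exists (C : E) (f : hom C X), Pd d M C /\
  forall (W : E) (g : hom W X), Pd d M W -> exists h : hom W C, f \c h = g.
Proof.
have [C [f [cohC fac]]] := approximation_tower X (leqnn _).
have [i1 [i2 [p1 [p2 [h1 h2 h3 h4 h5]]]]] := cpx_sumP C (mid (cover X)).
exists (cpx_sum C (mid (cover X))), (f \c p1 + defl (cover X) \c p2); split.
  by apply: Pd_sum; [exact: Pd_of_cohom | exact: cover_Pd].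
move=> W g PW; have [|u [v ->]] := fac W _ g.
  by move=> N PN n hn; exact: Pd_rigid.
exists (i1 \c u + i2 \c v); rewrite compDl -!compA !compDr !(compA p1)
  !(compA p2).
by rewrite h1 h2 h3 h4 !comp1m !comp0m !compm0 addr0 add0r.
Qed.

Lemma Pd_cluster_tilting : cluster_tilting (E := E) d (Pd d M).
Proof.
split.
- exact: Pd_additive Madd.
- move=> X; exists (syzygy X), (mid (cover X)), (infl (cover X)),
    (defl (cover X)).
  by split; [exact: cover_Pd | exact: sesP].
- move=> X; exists (mid (cocover X)), (suspension X), (infl (cocover X)),
    (defl (cocover X)).
  by split; [exact: cocover_Pd | exact: sesP].
- split=> X.
    have [C [f [PC hf]]] := right_approximation X.
    by exists C, f; split=> // W g PW; exact: hf.
  have [C [a [Pa ha]]] := left_approximation X.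
  by exists (mid a), (infl a); split=> // N g PN; exact: ha.
- by split; [exact: Pd_left_orthogonal | exact: Pd_right_orthogonal].
Qed.

End Main.

(* Right A-modules are left modules over the converse ring A^c. *)
Theorem theorem1p4 (d : nat) (hd : (1 <= d)%N) (k : fieldType) (A : falgType k)
  (M : fgmod_exact A^c -> Prop) (hM : cluster_tilting_mod d M) :
  cluster_tilting (E := projcomplex_exact A^c d) d (Pd d M).
Proof. exact: Pd_cluster_tilting. Qed.
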